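(* Let $\Gamma$ be a finite simple asymmetric graph, i.e. a graph whose automorphism group is trivial, and let $\Lambda$ be a finite simple graph. If $\mathrm{Aut}(A_\Lambda)$ embeds into $\mathrm{Aut}(A_\Gamma)$, then $\Lambda$ is also asymmetric. Likewise, if $\mathrm{Out}(A_\Lambda)$ embeds into $\mathrm{Out}(A_\Gamma)$, then $\Lambda$ is also asymmetric.
   Context: For a finite simple graph $\Gamma$, $A_\Gamma=\langle \mathrm{V}(\Gamma)\mid vw=wv \text{ for all }\{v,w\}\in\mathrm{E}(\Gamma)\rangle$ is the right-angled Artin group. $\mathrm{Out}(G)=\mathrm{Aut}(G)/\mathrm{Inn}(G)$. ''Embeds'' means that there is an injective group homomorphism. The automorphism group $\mathrm{Aut}(\Gamma)$ of a graph is its group of graph automorphisms. *)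

(* Defs.v *)
From HB Require Import structures.
From mathcomp Require Import all_boot all_fingroup.
From mathcomp Require Import boolp.

Set Implicit Arguments.
Unset Strict Implicit.
Unset Printing Implicit Defensive.

Local Open Scope group_scope.
Local Open Scope quotient_scope.

(* fingroup shadows this name. *)
Local Notation repr := generic_quotient.repr.

Record sgraph := SGraph {
  vertex :> finType;
  edge : rel vertex;
  edge_sym : symmetric edge;
  edge_irr : irreflexive edge }.

Definition graph_aut (Gamma : sgraph) : {set {perm Gamma}} :=
  [set s : {perm Gamma} |
    [forall x, forall y, edge (s x) (s y) == edge x y]].

Lemma graph_aut_group_set (Gamma : sgraph) : group_set (graph_aut Gamma).
Proof.
apply/group_setP; split=> [|s t].
  by rewrite inE; apply/'forall_'forall_eqP => x y; rewrite !perm1.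
rewrite !inE => /'forall_'forall_eqP sP /'forall_'forall_eqP tP.
by apply/'forall_'forall_eqP => x y; rewrite !permM tP sP.
Qed.

Canonical graph_aut_group (Gamma : sgraph) : {group {perm Gamma}} :=
  group (graph_aut_group_set Gamma).

Definition asymmetric (Gamma : sgraph) : Prop := graph_aut Gamma = 1.

(* The letter (x, true) stands for x and (x, false) for its inverse. *)
Definition word (X : Type) := seq (X * bool).

Section PresentedGroup.
Variables (X : choiceType) (rel0 : word X -> word X -> Prop).

(* The least congruence on words that contains the defining relations [rel0]
   (pairs of words to be identified) and free cancellation. *)
Inductive word_congr : word X -> word X -> Prop :=
| word_congr_refl u : word_congr u u
| word_congr_sym u v : word_congr u v -> word_congr v u
| word_congr_trans u v w : word_congr u v -> word_congr v w -> word_congr u w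
| word_congr_cat u u' v v' :
    word_congr u u' -> word_congr v v' -> word_congr (u ++ v) (u' ++ v')
| word_congr_cancel x b : word_congr [:: (x, b); (x, ~~ b)] [::]
| word_congr_rel u v : rel0 u v -> word_congr u v.

Definition word_eqv : rel (word X) := fun u v => `[< word_congr u v >].

Lemma word_eqv_refl : reflexive word_eqv.
Proof. by move=> u; apply/asboolP; exact: word_congr_refl. Qed.

Lemma word_eqv_sym : symmetric word_eqv.
Proof. by move=> u v; apply/asboolP/asboolP; exact: word_congr_sym. Qed.

Lemma word_eqv_trans : transitive word_eqv.
Proof.
by move=> v u w /asboolP uv /asboolP vw; apply/asboolP/(word_congr_trans uv).
Qed.

Canonical word_equiv : equiv_rel (word X) :=
  EquivRel word_eqv word_eqv_refl word_eqv_sym word_eqv_trans.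

Definition presented := {eq_quot word_equiv}.

HB.instance Definition _ := Choice.on presented.
HB.instance Definition _ := EqQuotient.on presented.

Implicit Types (u v w : word X) (a b c : presented).

Lemma presented_eqP u v :
  reflect (word_congr u v) (\pi_presented u == \pi_presented v).
Proof. by rewrite eqquotE; apply: asboolP. Qed.

Lemma presented_piE u v :
  word_congr u v -> \pi_presented u = \pi_presented v.
Proof. by move=> uv; apply/eqP/presented_eqP. Qed.

Lemma presented_reprP u : word_congr (repr (\pi_presented u)) u.
Proof. by apply/presented_eqP; rewrite reprK. Qed.

Definition word_inv u : word X := rev [seq (l.1, ~~ l.2) | l <- u].

Lemma word_invK : involutive word_inv.
Proof.
move=> u; rewrite /word_inv map_rev revK -map_comp -[RHS]map_id.
by apply: eq_map => -[x b] /=; rewrite negbK.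
Qed.

Lemma word_congr_mulV u : word_congr (u ++ word_inv u) [::].
Proof.
elim: u => [|[x b] u IHu]; first exact: word_congr_refl.
have -> : ((x, b) :: u) ++ word_inv ((x, b) :: u) =
    [:: (x, b)] ++ (u ++ word_inv u) ++ [:: (x, ~~ b)].
  by rewrite /word_inv /= rev_cons -cats1 catA.
have r := word_congr_refl; apply: word_congr_trans (word_congr_cancel x b).
apply: (word_congr_cat (r [:: (x, b)])).
exact: (word_congr_cat IHu (r [:: (x, ~~ b)])).
Qed.

Lemma word_congr_Vmul u : word_congr (word_inv u ++ u) [::].
Proof. by rewrite -{2}[u]word_invK; exact: word_congr_mulV. Qed.

Lemma word_congr_inv u v :
  word_congr u v -> word_congr (word_inv u) (word_inv v).
Proof.
move=> uv; have r := word_congr_refl.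
apply: (@word_congr_trans _ (word_inv u ++ (v ++ word_inv v))).
  rewrite -{1}[word_inv u]cats0; apply: word_congr_cat => //.
  exact/word_congr_sym/word_congr_mulV.
rewrite catA -{2}[word_inv v]cat0s; apply: word_congr_cat => //.
apply: word_congr_trans (word_congr_Vmul u).
by apply: word_congr_cat => //; exact: word_congr_sym.
Qed.

Definition presented_mul a b := \pi_presented (repr a ++ repr b).
Definition presented_one := \pi_presented [::].
Definition presented_inv a := \pi_presented (word_inv (repr a)).

Lemma presented_mulE u v :
  presented_mul (\pi u) (\pi v) = \pi_presented (u ++ v).
Proof. by apply: presented_piE; apply: word_congr_cat; exact: presented_reprP. Qed.

Lemma presented_invE u :
  presented_inv (\pi u) = \pi_presented (word_inv u).
Proof. by apply: presented_piE; apply: word_congr_inv; exact: presented_reprP. Qed.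

Lemma presented_mulA : associative presented_mul.
Proof.
move=> a b c; rewrite -[a]reprK -[b]reprK -[c]reprK.
by rewrite !presented_mulE catA.
Qed.

Lemma presented_mul1 : left_id presented_one presented_mul.
Proof. by move=> a; rewrite -[a]reprK presented_mulE. Qed.

Lemma presented_mulr1 : right_id presented_one presented_mul.
Proof. by move=> a; rewrite -[a]reprK presented_mulE cats0. Qed.

Lemma presented_mulV : left_inverse presented_one presented_inv presented_mul.
Proof.
move=> a; rewrite -[a]reprK presented_invE presented_mulE.
exact/presented_piE/word_congr_Vmul.
Qed.

Lemma presented_mulrV : right_inverse presented_one presented_inv presented_mul.
Proof.
move=> a; rewrite -[a]reprK presented_invE presented_mulE.
exact/presented_piE/word_congr_mulV.
Qed.

HB.instance Definition _ := isGroup.Build presented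
  presented_mulA presented_mul1 presented_mulr1 presented_mulV presented_mulrV.

End PresentedGroup.

Inductive raag_rel (Gamma : sgraph) : word Gamma -> word Gamma -> Prop :=
| RaagRel v w of edge v w :
    raag_rel [:: (v, true); (w, true)] [:: (w, true); (v, true)].

Definition raag (Gamma : sgraph) : groupType := presented (@raag_rel Gamma).

Section AutomorphismGroup.
Variable G : groupType.

(* fingroup's [Aut] only covers finite groups. *)
Definition is_group_aut : pred (G -> G) :=
  fun f => `[< {morph f : x y / x * y} /\ bijective f >].

Record group_aut :=
  GroupAut { group_aut_fun :> G -> G; _ : is_group_aut group_aut_fun }.

HB.instance Definition _ := [isSub for group_aut_fun].
HB.instance Definition _ := [Choice of group_aut by <:].

Implicit Types f g h : group_aut.

Lemma group_autM f : {morph f : x y / x * y}.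
Proof. by have /asboolP[] := valP f. Qed.

Lemma group_aut_bij f : bijective f.
Proof. by have /asboolP[] := valP f. Qed.

Lemma group_autP f g : f =1 g -> f = g.
Proof. by move=> fg; apply/val_inj/funext. Qed.

Lemma is_group_aut_comp f g : is_group_aut (f \o g).
Proof.
apply/asboolP; split=> [x y|]; first by rewrite /= !group_autM.
exact: bij_comp (group_aut_bij f) (group_aut_bij g).
Qed.

Lemma is_group_aut_id : is_group_aut idfun.
Proof. by apply/asboolP; split=> //; exists idfun. Qed.

Lemma group_aut_has_inv f : exists h : group_aut, cancel f h /\ cancel h f.
Proof.
have [h fK hK] := group_aut_bij f.
suff hP : is_group_aut h by exists (GroupAut hP).
apply/asboolP; split; last by exists f.
by move=> x y; apply: (can_inj fK); rewrite group_autM !hK.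
Qed.

Definition group_aut_mul f g := GroupAut (is_group_aut_comp f g).
Definition group_aut_one := GroupAut is_group_aut_id.
Definition group_aut_inv f := projT1 (cid (group_aut_has_inv f)).

Lemma group_aut_invP f : cancel f (group_aut_inv f) /\ cancel (group_aut_inv f) f.
Proof. exact: projT2 (cid (group_aut_has_inv f)). Qed.

Lemma group_aut_mulA : associative group_aut_mul.
Proof. by move=> f g h; apply: group_autP. Qed.

Lemma group_aut_mul1 : left_id group_aut_one group_aut_mul.
Proof. by move=> f; apply: group_autP. Qed.

Lemma group_aut_mulr1 : right_id group_aut_one group_aut_mul.
Proof. by move=> f; apply: group_autP. Qed.

Lemma group_aut_mulV : left_inverse group_aut_one group_aut_inv group_aut_mul.
Proof. by move=> f; apply: group_autP; case: (group_aut_invP f). Qed.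

Lemma group_aut_mulrV : right_inverse group_aut_one group_aut_inv group_aut_mul.
Proof. by move=> f; apply: group_autP; case: (group_aut_invP f). Qed.

HB.instance Definition _ := isGroup.Build group_aut
  group_aut_mulA group_aut_mul1 group_aut_mulr1 group_aut_mulV group_aut_mulrV.

Lemma group_aut_mulE f g x : (f * g) x = f (g x).
Proof. by []. Qed.

Lemma group_aut_funK f : cancel f f^-1.
Proof. by case: (group_aut_invP f). Qed.

Lemma group_aut_funVK f : cancel f^-1 f.
Proof. by case: (group_aut_invP f). Qed.

Definition inner f : Prop := exists a : G, forall x, f x = x ^ a.

Lemma inner1 : inner 1.
Proof. by exists 1 => x; rewrite conjg1. Qed.

Lemma innerM f g : inner f -> inner g -> inner (f * g).
Proof.
move=> [a fE] [b gE]; exists (b * a) => x.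
by rewrite group_aut_mulE fE gE conjgM.
Qed.

Lemma innerV f : inner f -> inner f^-1.
Proof.
move=> [a fE]; exists a^-1 => x.
by apply: (can_inj (group_aut_funK f)); rewrite group_aut_funVK fE conjgKV.
Qed.

Lemma group_autV f : {morph f : x / x^-1}.
Proof.
have f1 : f 1 = 1 by apply: (mulgI (f 1)); rewrite -group_autM !mulg1.
by move=> x; apply: (mulgI (f x)); rewrite -group_autM !mulgV.
Qed.

Lemma innerJ f g : inner f -> inner (f ^ g).
Proof.
move=> [a fE]; exists (g^-1 a) => x.
rewrite conjgE !group_aut_mulE fE !conjgE !group_autM group_autV.
by rewrite group_aut_funK.
Qed.

(* Equality of the cosets of f and g modulo Inn(G), which is normal. *)
Definition out_eqv : rel group_aut := fun f g => `[< inner (f^-1 * g) >].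

Lemma out_eqv_refl : reflexive out_eqv.
Proof. by move=> f; apply/asboolP; rewrite mulVg; exact: inner1. Qed.

Lemma out_eqv_sym : symmetric out_eqv.
Proof.
by move=> f g; apply/asboolP/asboolP => /innerV; rewrite invgM invgK.
Qed.

Lemma out_eqv_trans : transitive out_eqv.
Proof.
move=> g f h /asboolP fg /asboolP gh; apply/asboolP.
by have := innerM fg gh; rewrite mulgA mulgK.
Qed.

Canonical out_equiv : equiv_rel group_aut :=
  EquivRel out_eqv out_eqv_refl out_eqv_sym out_eqv_trans.

Definition group_out := {eq_quot out_equiv}.

HB.instance Definition _ := Choice.on group_out.
HB.instance Definition _ := EqQuotient.on group_out.

Implicit Types p q r : group_out.

Lemma group_out_eqP f g :
  reflect (inner (f^-1 * g)) (\pi_group_out f == \pi_group_out g).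
Proof. by rewrite eqquotE; apply: asboolP. Qed.

Lemma group_out_reprP f : inner ((repr (\pi_group_out f))^-1 * f).
Proof. by apply/group_out_eqP; rewrite reprK. Qed.

Definition group_out_mul p q := \pi_group_out (repr p * repr q).
Definition group_out_one := \pi_group_out 1.
Definition group_out_inv p := \pi_group_out (repr p)^-1.

Lemma group_out_mulE f g :
  group_out_mul (\pi f) (\pi g) = \pi_group_out (f * g).
Proof.
apply/eqP/group_out_eqP; rewrite invgM.
have Hg := group_out_reprP g; have /(innerJ g) Hf := group_out_reprP f.
have := innerM Hg Hf; rewrite conjgE !mulgA mulgK.
by rewrite -!mulgA.
Qed.

Lemma group_out_invE f : group_out_inv (\pi f) = \pi_group_out f^-1.
Proof.
apply/eqP/group_out_eqP; rewrite invgK.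
have /innerV/(innerJ f^-1) := group_out_reprP f.
by rewrite conjgE invgM !invgK !mulgA mulgV mul1g.
Qed.

Lemma group_out_mulA : associative group_out_mul.
Proof.
move=> p q r; rewrite -[p]reprK -[q]reprK -[r]reprK.
by rewrite !group_out_mulE mulgA.
Qed.

Lemma group_out_mul1 : left_id group_out_one group_out_mul.
Proof. by move=> p; rewrite -[p]reprK group_out_mulE mul1g. Qed.

Lemma group_out_mulr1 : right_id group_out_one group_out_mul.
Proof. by move=> p; rewrite -[p]reprK group_out_mulE mulg1. Qed.

Lemma group_out_mulV : left_inverse group_out_one group_out_inv group_out_mul.
Proof. by move=> p; rewrite -[p]reprK group_out_invE group_out_mulE mulVg. Qed.

Lemma group_out_mulrV : right_inverse group_out_one group_out_inv group_out_mul.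
Proof. by move=> p; rewrite -[p]reprK group_out_invE group_out_mulE mulgV. Qed.

HB.instance Definition _ := isGroup.Build group_out
  group_out_mulA group_out_mul1 group_out_mulr1 group_out_mulV group_out_mulrV.

End AutomorphismGroup.

Definition embeds (G H : groupType) : Prop :=
  exists f : {multiplicative G -> H}, injective f.

(* Main.v *)
Require Import Defs.
From mathcomp Require Import all_boot all_fingroup.
From mathcomp Require Import ssralg ssrint rat matrix mxalgebra zmodp.
From mathcomp Require Import boolp ring zify.

(** Write A(G) for the right-angled Artin group of a graph G. If Lambda has a
symmetry s with s w = v and v <> w, then the commutator of the inversion of
the generator v with s is the product of the inversions of v and w: an
involution of A(Lambda) that is not inner, because homology sees it
([symmetric_commutator]). So it suffices to show, for Gamma asymmetric, that a
commutator c of automorphisms of A = A(Gamma) is inner as soon as its square is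
([commutator_inner]), and trivial as soon as its square is
([commutator_trivial]). An embedding of automorphism groups, or of outer
automorphism groups, then cannot exist unless Lambda is asymmetric.

First, c acts trivially on the first homology. The matrix of an automorphism
satisfies quadratic relations saying that adjacent generators have commuting
images. By comparing dimensions of centralizers, these relations force the
matrix to be triangular with respect to the degree of vertices, up to a
symmetry of the graph ([rigid_triangular]). As Gamma has no symmetry, diagonal
entries are multiplicative, so c has diagonal entries 1; being an integral
unipotent matrix of square 1, it is the identity ([unipotent_involution]).

Second, c is approximated by conjugations. The Magnus representation sends a
generator v to 1 + v in the algebra of partially commutative polynomials,
truncated in degree N. Its coefficients, over K = Z/3^m, are polynomial
functions on A, on which c acts unipotently, hence with order a power of 3.
If the square of c is conjugation by g then, 2 being prime to 3, c agrees with
conjugation by a power of g up to degree N ([involution_approx]). If g = 1,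
faithfulness of the representation ([magnus_faithful]) gives c = 1.

Third, a single element of A does this for all m and N at once. Traces show
that c(v) is conjugate to v in A itself ([magnus_conj_gen]), say by a_v. Hence
a_v times the approximating power z of g commutes with v up to degree N, so it
coincides with its retraction to the subgroup generated by the star of v
([magnus_centralizer]). This says that z equals b_v times its retraction, where
b_v in A depends neither on m nor on N. Chaining these equalities over all v
gives z = B z', where z' lies in the subgroup generated by the vertices adjacent
to all others ([retract_descent]). That subgroup is central, so c is
conjugation by the inverse of B ([unipotent_square_inner]). *)

Set Implicit Arguments.
Unset Strict Implicit.
Unset Printing Implicit Defensive.

Import GRing.Theory.

Local Notation repr := generic_quotient.repr.
Local Notation Z3 m := 'Z_(3 ^ m.+1).

(** * Matrices compatible with a rigid graph *)

Section Triangular.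
Local Open Scope ring_scope.
Variables (F : fieldType) (n : nat) (adj : rel 'I_n) (X : 'M[F]_n).
Hypothesis adj_sym : symmetric adj.
Hypothesis adj_irr : irreflexive adj.
Hypothesis adj_rigid : forall s : 'S_n,
  (forall x y, adj x y -> adj (s x) (s y)) -> s = 1%g.
Hypothesis X_unit : X \in unitmx.
Hypothesis X_adj : forall v v' w w', adj v v' -> ~~ adj w w' ->
  X v w * X v' w' = X v w' * X v' w.

Let star v := [set u | (u == v) || adj v u].
Let deg v := #|star v|.

Let sub_rows v := rowsub (fun i : 'I_(deg v) => enum_val i) X.
Let minor v w := \matrix_(i < deg v, j < deg w) X (enum_val i) (enum_val j).

Lemma star_self v : v \in star v. Proof. by rewrite inE eqxx. Qed.

(** The relations between row v and the rows indexed by the star of v are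
linear in the latter, so they pass to linear combinations. *)
Lemma combination_local v w w' (z : 'rV[F]_(deg v)) :
    ~~ adj w w' ->
  X v w * (z *m sub_rows v) 0 w' = X v w' * (z *m sub_rows v) 0 w.
Proof.
move=> nadj_ww'; rewrite !mxE !mulr_sumr; apply: eq_bigr => i _.
rewrite !mxE mulrCA [RHS]mulrCA; congr (_ * _).
have := enum_valP i; rewrite inE => /predU1P[->|adj_vi]; first by rewrite mulrC.
exact: X_adj.
Qed.

Lemma combination_support v w (z : 'rV[F]_(deg v)) u :
    X v w != 0 -> (z *m sub_rows v) 0 w = 0 -> u \notin star w ->
  (z *m sub_rows v) 0 u = 0.
Proof.
move=> Xvw zw; rewrite inE negb_or => /andP[_ nadj_wu].
have := combination_local z nadj_wu.
by rewrite zw mulr0 => /eqP; rewrite mulf_eq0 (negPf Xvw) => /eqP.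
Qed.

Lemma minorE v w (z : 'rV[F]_(deg v)) j :
  (z *m minor v w) 0 j = (z *m sub_rows v) 0 (enum_val j).
Proof. by rewrite !mxE; apply: eq_bigr => i _; rewrite !mxE. Qed.

Lemma combination_free v (z : 'rV[F]_(deg v)) : z *m sub_rows v = 0 -> z = 0.
Proof.
rewrite /sub_rows -[X in rowsub _ X]mul1mx -mul_rowsub_mx mulmxA => zX0.
have z0 : z *m rowsub (fun i : 'I_(deg v) => enum_val i) 1%:M = 0 :> 'rV_n.
  by apply: (can_inj (mulmxK X_unit)); rewrite zX0 mul0mx.
apply/rowP => i; move/rowP/(_ (enum_val i)): z0; rewrite !mxE => <-.
rewrite (bigD1 i) //= big1 => [|j neq_ji]; rewrite !mxE ?eqxx ?mulr1 ?addr0 //.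
by rewrite (inj_eq enum_val_inj) (negPf neq_ji) mulr0.
Qed.

(** A combination of the rows in the star of v that vanishes on the star of w
vanishes everywhere, by [combination_support]; and the rows of X are
independent. *)
Lemma minor_free v w : X v w != 0 -> row_free (minor v w).
Proof.
move=> Xvw; rewrite -kermx_eq0; apply/eqP/row_matrixP => i; rewrite row0.
set z := row i _; have zY : z *m minor v w = 0.
  by apply/sub_kermxP; rewrite row_sub.
apply: combination_free; apply/rowP => u; rewrite [RHS]mxE.
have z_star t : t \in star w -> (z *m sub_rows v) 0 t = 0.
  move=> st; have := minorE z (enum_rank_in st t).
  by rewrite zY mxE enum_rankK_in // => <-.
have [/z_star //|] := boolP (u \in star w).
by apply: combination_support Xvw _; apply: z_star; exact: star_self.
Qed.

Lemma support_deg v w : X v w != 0 -> (deg v <= deg w)%N.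
Proof. by move/minor_free/eqnP <-; exact: rank_leq_col. Qed.

(** When the degrees agree the minor is square, so some combination of the rows
in the star of v restricts to the unit vector at u on the star of w. By
[combination_support] it is that unit vector, and its relations with row v
force u into the star of every vertex of the support. *)
Lemma support_dominated v w w'' u : X v w != 0 -> deg v = deg w ->
  X v w'' != 0 -> adj w u -> u \in star w''.
Proof.
move=> Xvw eq_deg Xvw'' adj_wu.
have neq_uw : u != w by apply: contraTneq adj_wu => ->; rewrite adj_irr.
have st_u : u \in star w by rewrite inE adj_wu orbT.
have full : row_full (minor v w).
  by rewrite /row_full -[eqbRHS]eq_deg; exact: minor_free.
have /submxP[z zY] : ((delta_mx 0%R (enum_rank_in st_u u) : 'rV_(deg w))
     <= minor v w)%MS.
  exact: submx_full.
have z_star t : t \in star w -> (z *m sub_rows v) 0 t = (t == u)%:R.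
  move=> st; have := minorE z (enum_rank_in st t).
  rewrite -zY mxE enum_rankK_in // => <-; congr _%:R.
  rewrite eqxx /= -(inj_eq enum_val_inj) !enum_rankK_in //.
have zw : (z *m sub_rows v) 0 w = 0.
  by rewrite z_star ?star_self // eq_sym (negPf neq_uw).
rewrite inE; apply: contraNT Xvw''; rewrite negb_or => /andP[neq nadj].
have := combination_local z nadj; rewrite z_star // eqxx mulr1 => ->.
have [st|nst] := boolP (w'' \in star w).
  by rewrite z_star // (eq_sym w'') (negPf neq) mulr0.
by rewrite (combination_support Xvw zw nst) mulr0.
Qed.

(** Both vertices dominate each other by [support_dominated], so exchanging
them preserves adjacency. *)
Lemma support_unique v w w'' : X v w != 0 -> X v w'' != 0 ->
  deg w = deg v -> deg w'' = deg v -> w = w''.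
Proof.
move=> Xw Xw'' dw dw''.
have dom := support_dominated Xw (esym dw) Xw''.
have dom'' := support_dominated Xw'' (esym dw'') Xw.
have dom1 y : adj w y -> y != w'' -> adj w'' y.
  by move=> /dom; rewrite inE => /predU1P[->|//]; rewrite eqxx.
have dom2 y : adj w'' y -> y != w -> adj w y.
  by move=> /dom''; rewrite inE => /predU1P[->|//]; rewrite eqxx.
have : tperm w w'' = 1%g.
  apply: adj_rigid => x y.
  case: tpermP => [->|->|/eqP xw /eqP xw''];
    case: tpermP => [->|->|/eqP yw /eqP yw''];
    rewrite ?adj_irr //.
  - by rewrite adj_sym.
  - by move/dom1; apply.
  - by rewrite adj_sym.
  - by move/dom2; apply.
  - by rewrite adj_sym => /dom1/(_ xw''); rewrite adj_sym.
  - by rewrite adj_sym => /dom2/(_ xw); rewrite adj_sym.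
by move/permP/(_ w); rewrite tpermL perm1.
Qed.

(** A nonzero term of the determinant is a permutation s running along the
support of X. Degrees cannot drop along the support, so s preserves them; by
[support_unique] s v is then the only vertex of its degree supporting row v,
which makes s compatible with adjacency, hence trivial. *)
Theorem rigid_triangular v w : X v w != 0 -> v = w \/ (deg v < deg w)%N.
Proof.
have [s Xs] : exists s : 'S_n, forall v, X v (s v) != 0.
  have : \det X != 0 by rewrite -unitfE -unitmxE.
  case: (pselect (exists s : 'S_n, forall v, X v (s v) != 0)) => // no_s.
  rewrite /determinant big1 ?eqxx // => s _; apply/eqP; rewrite mulf_eq0.
  apply/orP; right; rewrite prodf_seq_eq0; apply/hasPn => all0.
  case: no_s; exists s => u; by have := all0 u; rewrite mem_index_enum; apply.
have deg_s u : deg (s u) = deg u.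
  (* termwise inequality with equal sums *)
  have le_s t : (deg t <= deg (s t) ?= iff (deg t == deg (s t)))%N.
    by split=> //; exact: support_deg.
  have [_] := leqif_sum (P := predT) (fun t _ => le_s t).
  rewrite [X in _ == X](_ : _ = \sum_i deg i)%N; last first.
    by rewrite [RHS](reindex_inj (@perm_inj _ s)).
  by rewrite eqxx => /esym/forallP/(_ u)/eqP <-.
have s1 : s = 1%g.
  apply: adj_rigid => x y adj_xy; apply: contraT => nadj.
  have neq : s x != s y.
    by rewrite (inj_eq perm_inj); apply: contraTneq adj_xy => ->;
      rewrite adj_irr.
  have := X_adj adj_xy nadj => /esym/eqP.
  have nz : X x (s x) * X y (s y) != 0 by rewrite mulf_neq0.
  move/eqP=> E; rewrite -E mulf_eq0 negb_or in nz; case/andP: nz => nz1 nz2.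
  have le1 := support_deg nz1; have le2 := support_deg nz2.
  rewrite !deg_s in le1 le2.
  have e : deg x = deg y by apply/eqP; rewrite eqn_leq le1 le2.
  case/negP: neq; apply/eqP; apply: (@support_unique x) => //.
  by rewrite deg_s.
move=> Xvw; have := support_deg Xvw; rewrite leq_eqVlt => /orP[/eqP e|];
  last by right.
left; apply: (@support_unique v) => //.
by have := Xs v; rewrite s1 perm1.
Qed.

End Triangular.

(** * Words and homomorphisms *)

Section RaagLift.
Local Open Scope group_scope.
Local Open Scope quotient_scope.
Variable Gamma : sgraph.
Local Notation A := (raag Gamma).
Local Notation rrel := (@raag_rel Gamma).

Definition word_class (w : word Gamma) : A := \pi_(presented rrel) w.
Definition gen (v : Gamma) : A := word_class [:: (v, true)].

Lemma word_class_repr (x : A) : word_class (repr x) = x.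
Proof. exact: generic_quotient.reprK. Qed.

Lemma word_classM u w : word_class u * word_class w = word_class (u ++ w).
Proof. exact: presented_mulE. Qed.

Lemma word_classP u w : word_congr rrel u w -> word_class u = word_class w.
Proof. exact: presented_piE. Qed.

Lemma word_classW u w : word_class u = word_class w -> word_congr rrel u w.
Proof. by move/eqP/presented_eqP. Qed.

Lemma gen_commute v w : edge v w -> commute (gen v) (gen w).
Proof.
by move=> vw; rewrite /commute !word_classM; apply/word_classP/word_congr_rel.
Qed.

Lemma gen_inv v : (gen v)^-1 = word_class [:: (v, false)].
Proof. exact: presented_invE. Qed.

Lemma raag_ind (P : A -> Prop) :
    P 1 -> (forall v x, P x -> P (gen v * x)) ->
    (forall v x, P x -> P ((gen v)^-1 * x)) ->
  forall x, P x.
Proof.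
move=> P1 Pg PV x; rewrite -[x]word_class_repr.
elim: (repr x) => [|[v b] w IHw]; first exact: P1.
rewrite -cat1s -word_classM; case: b; first exact: Pg.
by rewrite -gen_inv; exact: PV.
Qed.

Section Lift.
Variables (H : groupType) (f : Gamma -> H).
Hypothesis fC : forall v w, edge v w -> commute (f v) (f w).

Definition word_val (w : word Gamma) : H :=
  foldr (fun l y => (if l.2 then f l.1 else (f l.1)^-1) * y) 1 w.

Lemma word_val_cat u w : word_val (u ++ w) = word_val u * word_val w.
Proof. by elim: u => [|l u IHu] /=; rewrite ?mul1g // IHu mulgA. Qed.

Lemma word_val_congr u w : word_congr rrel u w -> word_val u = word_val w.
Proof.
elim=> {u w} [//|u w _ //|u w t _ -> _ //|||].
- by move=> u u' w w' _ Eu _ Ew; rewrite !word_val_cat Eu Ew.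
- by move=> v [] /=; rewrite mulg1 ?mulgV ?mulVg.
- by move=> _ _ [v w vw] /=; rewrite !mulg1; exact: fC.
Qed.

Definition raag_lift (x : A) : H := word_val (repr x).

Lemma raag_liftE w : raag_lift (word_class w) = word_val w.
Proof. exact/word_val_congr/presented_reprP. Qed.

Lemma raag_liftM : {morph raag_lift : x y / x * y}.
Proof.
move=> x y; rewrite -[x]word_class_repr -[y]word_class_repr word_classM.
by rewrite !raag_liftE word_val_cat.
Qed.

Lemma raag_lift_gen v : raag_lift (gen v) = f v.
Proof. by rewrite raag_liftE /= mulg1. Qed.

End Lift.

Lemma morph_one (G H : groupType) (h : G -> H) :
  {morph h : x y / x * y} -> h 1 = 1.
Proof. by move=> hM; apply: (mulgI (h 1)); rewrite -hM !mulg1. Qed.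

Lemma morph_inv (G H : groupType) (h : G -> H) :
  {morph h : x y / x * y} -> {morph h : x / x^-1}.
Proof. by move=> hM x; apply: (mulgI (h x)); rewrite -hM !mulgV morph_one. Qed.

Lemma raag_morph_eq (H : groupType) (h k : A -> H) :
    {morph h : x y / x * y} -> {morph k : x y / x * y} ->
  (forall v, h (gen v) = k (gen v)) -> h =1 k.
Proof.
move=> hM kM hk; apply: raag_ind => [|v x IH|v x IH];
  first by rewrite !morph_one.
  by rewrite hM kM hk IH.
by rewrite hM kM !(morph_inv hM) !(morph_inv kM) hk IH.
Qed.

Lemma raag_commute (H : groupType) (h : A -> H) (z : H) :
    {morph h : x y / x * y} -> (forall v, commute z (h (gen v))) ->
  forall x, commute z (h x).
Proof.
move=> hM zC; elim/raag_ind => [|v x IH|v x IH].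
- by rewrite morph_one //; exact: commute1.
- by rewrite hM; apply: commuteM.
- by rewrite hM (morph_inv hM); apply: commuteM => //; exact: commuteV.
Qed.

End RaagLift.

(** * The truncated Magnus representation *)

Section Magnus.
Local Open Scope ring_scope.
Variables (Gamma : sgraph) (K : comNzRingType).
Local Notation A := (raag Gamma).
Implicit Types (phi psi : seq Gamma -> K) (s t : seq Gamma) (v w : Gamma).

(** Functions on words that factor through the partially commutative monoid. *)
Definition trace_inv phi := forall s t v w, edge v w ->
  phi (s ++ v :: w :: t) = phi (s ++ w :: v :: t).

(** Linear forms on the algebra of partially commutative polynomials truncated
in degree N, given by their values on monomials. All computations with the
algebra are carried out on this dual side, where no quotient is needed. *)
Definition trace_form N phi :=
  trace_inv phi /\ forall t, (N <= size t)%N -> phi t = 0.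

Definition shiftr v phi t := phi (rcons t v).
Definition shiftl s phi t := phi (s ++ t).

(** The transpose of right multiplication by 1 + v, and by its inverse, the
geometric series in - v cut at degree N. *)
Definition letter_act N (l : Gamma * bool) phi t : K :=
  if l.2 then phi t + phi (rcons t l.1)
  else \sum_(k < N) (-1) ^+ k * phi (t ++ nseq k l.1).
Definition word_act N (u : word Gamma) phi := foldr (letter_act N) phi u.

Definition magnus N (x : A) phi := word_act N (repr x) phi.

Lemma trace_form_leq M N phi : (M <= N)%N -> trace_form M phi ->
  trace_form N phi.
Proof.
by move=> MN [ti tb]; split=> // t Nt; apply: tb; apply: leq_trans Nt.
Qed.

Lemma trace_formD N phi psi : trace_form N phi -> trace_form N psi ->
  trace_form N (phi \+ psi).
Proof.
move=> [ip bp] [iq bq]; split=> [s t v w vw|t Nt] /=.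
  by rewrite (ip _ _ _ _ vw) (iq _ _ _ _ vw).
by rewrite bp // bq // addr0.
Qed.

Lemma trace_formZ N a phi : trace_form N phi ->
  trace_form N (fun t => a * phi t).
Proof.
move=> [ip bp]; split=> [s t v w vw|t Nt] /=; first by rewrite (ip _ _ _ _ vw).
by rewrite bp // mulr0.
Qed.

Lemma trace_form_shiftr N v phi : trace_form N phi ->
  trace_form N (shiftr v phi).
Proof.
move=> [ip bp]; split=> [s t x y xy|t Nt]; rewrite /shiftr.
  by rewrite !rcons_cat /= (ip _ _ _ _ xy).
by apply: bp; rewrite size_rcons ltnW.
Qed.

Lemma trace_form_shiftl N s phi : trace_form N phi ->
  trace_form N (shiftl s phi).
Proof.
move=> [ip bp]; split=> [s' t x y xy|t Nt]; rewrite /shiftl.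
  by rewrite !catA (ip _ _ _ _ xy).
by apply: bp; rewrite size_cat (leq_trans Nt) // leq_addl.
Qed.

Lemma trace_form_letter M N l phi : trace_form N phi ->
  trace_form N (letter_act M l phi).
Proof.
case: l => v [] tp; first exact: trace_formD tp (trace_form_shiftr v tp).
have [ip bp] := tp; split=> [s t x y xy|t Nt]; rewrite /letter_act /=.
  by apply: eq_bigr => k _; rewrite -!catA /= (ip _ _ _ _ xy).
rewrite big1 // => k _; rewrite bp; first by rewrite mulr0.
by rewrite size_cat (leq_trans Nt) // leq_addr.
Qed.

Lemma trace_form_word M N u phi : trace_form N phi ->
  trace_form N (word_act M u phi).
Proof. by move=> tp; elim: u => // l u; exact: trace_form_letter. Qed.

Lemma word_act_cat N u1 u2 phi :
  word_act N (u1 ++ u2) phi = word_act N u1 (word_act N u2 phi).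
Proof. exact: foldr_cat. Qed.

Lemma letter_actK N v b phi : trace_form N phi ->
  letter_act N (v, b) (letter_act N (v, ~~ b) phi) = phi.
Proof.
move=> [ip bp]; apply/funext => t; rewrite /letter_act.
have telescope k : \sum_(i < k) (-1) ^+ i * phi (t ++ nseq i v) +
    \sum_(i < k) (-1) ^+ i * phi (rcons t v ++ nseq i v) =
    phi t - (-1) ^+ k * phi (t ++ nseq k v).
  rewrite -big_split /=; elim: k => [|k IHk].
    by rewrite big_ord0 cats0 expr0 mul1r subrr.
  rewrite big_ord_recr IHk /= cat_rcons exprS mulN1r mulNr opprK -addrA.
  by congr (_ + _); rewrite addKr.
have end0 : phi (t ++ nseq N v) = 0.
  by apply: bp; rewrite size_cat size_nseq leq_addl.
case: b => /=; first by rewrite telescope end0 mulr0 subr0.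
transitivity (phi t - (-1) ^+ N * phi (t ++ nseq N v)); last first.
  by rewrite end0 mulr0 subr0.
rewrite -telescope -big_split /=.
apply: eq_bigr => k _; rewrite mulrDr -cats1 -!catA.
have -> : nseq k v ++ [:: v] = [:: v] ++ nseq k v.
  by elim: (k : nat) => //= i ->.
by rewrite catA cats1.
Qed.

Lemma word_act_congr N u1 u2 phi : trace_form N phi ->
  word_congr (@raag_rel Gamma) u1 u2 -> word_act N u1 phi = word_act N u2 phi.
Proof.
move=> tp u12; elim: u12 phi tp => {u1 u2} [//|||||].
- by move=> u w _ IH phi tp; rewrite IH.
- by move=> u w t _ IH1 _ IH2 phi tp; rewrite IH1 ?IH2.
- move=> u u' w w' _ IHu _ IHw phi tp; rewrite !word_act_cat IHw //.
  by rewrite IHu //; exact: trace_form_word.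
- by move=> x b phi tp; exact: letter_actK.
- move=> _ _ [v w vw] phi [ip _]; apply/funext => t; rewrite /= /letter_act /=.
  have -> : phi (rcons (rcons t v) w) = phi (rcons (rcons t w) v).
    by rewrite -!cats1 -!catA /= (ip _ _ _ _ vw).
  by rewrite -!addrA; congr (_ + _); rewrite addrCA.
Qed.

Lemma magnus_class N u phi :
  trace_form N phi -> magnus N (word_class u) phi = word_act N u phi.
Proof.
by move=> tp; apply: word_act_congr => //;
  exact: word_classW (word_class_repr _).
Qed.

Lemma trace_form_magnus M N x phi : trace_form N phi ->
  trace_form N (magnus M x phi).
Proof. exact: trace_form_word. Qed.

Lemma magnusM N x y phi :
  trace_form N phi -> magnus N (x * y)%g phi = magnus N x (magnus N y phi).
Proof.
move=> tp; rewrite -[x]word_class_repr -[y]word_class_repr word_classM.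
by rewrite !magnus_class ?word_act_cat //; apply: trace_form_word.
Qed.

Lemma magnus1 N phi : trace_form N phi -> magnus N 1%g phi = phi.
Proof. exact: (@magnus_class N [::]). Qed.

Lemma magnus_gen N v phi t : trace_form N phi ->
  magnus N (gen v) phi t = phi t + phi (rcons t v).
Proof. by move=> tp; rewrite magnus_class. Qed.

(** On words of maximal length, the terms of positive degree of the image of x
contribute only values of phi on longer words. *)
Lemma magnus_top M N x phi t : (0 < M)%N -> trace_form N.+1 phi -> (N <= size t)%N ->
  magnus M x phi t = phi t.
Proof.
case: M => // M _ tp Nt; rewrite /magnus; elim: (repr x) => //= -[v b] u <-.
have [_ top] : trace_form N.+1 (word_act M.+1 u phi) by exact: trace_form_word.
rewrite /letter_act; case: b => /=.
  by rewrite [X in _ + X]top ?addr0 // size_rcons ltnS.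
rewrite big_ord_recl /= cats0 expr0 mul1r big1 ?addr0 // => k _.
by rewrite top ?mulr0 // size_cat /= addnS ltnS (leq_trans Nt) ?leq_addr.
Qed.

(** Left and right multiplications commute. *)
Lemma magnus_shiftl N s x phi t : magnus N x (shiftl s phi) t = magnus N x phi (s ++ t).
Proof.
rewrite /magnus; elim: (repr x) t => //= -[v b] u IHu t; rewrite /letter_act.
case: b; rewrite /= ?IHu ?rcons_cat //.
by apply: eq_bigr => k _; rewrite IHu catA.
Qed.

Lemma magnusD N x phi psi :
  magnus N x (phi \+ psi) = magnus N x phi \+ magnus N x psi.
Proof.
rewrite /magnus; elim: (repr x) => //= -[v b] u ->; apply/funext => t.
rewrite /letter_act; case: b => /=; first by rewrite addrACA.
by rewrite -big_split; apply: eq_bigr => k _; rewrite mulrDr.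
Qed.

Lemma magnusZ N x a phi :
  magnus N x (fun t => a * phi t) = fun t => a * magnus N x phi t.
Proof.
rewrite /magnus; elim: (repr x) => //= -[v b] u ->; apply/funext => t.
rewrite /letter_act; case: b => /=; first by rewrite mulrDr.
by rewrite mulr_sumr; apply: eq_bigr => k _; rewrite mulrCA.
Qed.

(** The value of the linear form phi at the image of x in the truncated
algebra. *)
Definition coef N x phi := magnus N x phi [::].

Lemma magnus_coef N x phi t : magnus N x phi t = coef N x (shiftl t phi).
Proof. by rewrite /coef magnus_shiftl cats0. Qed.

Lemma coefM N x y phi :
  trace_form N phi -> coef N (x * y)%g phi = coef N x (magnus N y phi).
Proof. by move=> tp; rewrite /coef magnusM. Qed.

(** Equality of the images of x and y in the truncated algebra over K, tested
on all linear forms. *)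
Definition magnus_eq N x y := forall phi, trace_form N phi -> coef N x phi = coef N y phi.

Lemma magnus_eq_act N x y phi : magnus_eq N x y -> trace_form N phi ->
  magnus N x phi = magnus N y phi.
Proof.
by move=> xy tp; apply/funext => t; rewrite !magnus_coef xy //;
  exact: trace_form_shiftl.
Qed.

Lemma magnus_eq_refl N x : magnus_eq N x x. Proof. by []. Qed.

Lemma magnus_eq_sym N x y : magnus_eq N x y -> magnus_eq N y x.
Proof. by move=> xy phi tp; rewrite xy. Qed.

Lemma magnus_eq_trans N y x z :
  magnus_eq N x y -> magnus_eq N y z -> magnus_eq N x z.
Proof. by move=> xy yz phi tp; rewrite xy ?yz. Qed.

Lemma magnus_eqM N x x' y y' :
  magnus_eq N x x' -> magnus_eq N y y' -> magnus_eq N (x * y)%g (x' * y')%g.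
Proof.
move=> xx' yy' phi tp; rewrite !coefM // (magnus_eq_act yy') // xx' //.
exact: trace_form_magnus.
Qed.

Lemma magnus_eqV N x y : magnus_eq N x y -> magnus_eq N x^-1%g y^-1%g.
Proof.
move=> xy; rewrite -[x^-1%g]mulg1 -(mulgV y) -[y^-1%g in X in magnus_eq _ _ X]mul1g.
rewrite mulgA; apply: magnus_eqM => //; rewrite -(mulVg x).
by apply: magnus_eqM => //; exact: magnus_eq_sym.
Qed.

Lemma magnus_eqJ N x x' y y' :
  magnus_eq N x x' -> magnus_eq N y y' -> magnus_eq N (x ^ y)%g (x' ^ y')%g.
Proof.
move=> xx' yy'; apply: magnus_eqM; first exact: magnus_eqV.
exact: magnus_eqM.
Qed.

End Magnus.

(** * Exponent sums *)

Section Exponents.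
Local Open Scope ring_scope.
Variable Gamma : sgraph.
Local Notation A := (raag Gamma).
Implicit Types (v w : Gamma) (x y : A).

Definition word_expo w (u : word Gamma) : int :=
  \sum_(l <- u) if l.1 == w then (if l.2 then 1 else -1) else 0.

Lemma word_expo_congr w u1 u2 :
  word_congr (@raag_rel Gamma) u1 u2 -> word_expo w u1 = word_expo w u2.
Proof.
rewrite /word_expo; elim=> {u1 u2} [//|u t _ //|u t t' _ -> _ //|||].
- by move=> u u' t t' _ Eu _ Et; rewrite !big_cat /= Eu Et.
- move=> x b; rewrite !big_cons big_nil /=.
  by case: (x == w); case: b; rewrite ?addr0 ?subrr ?addNr.
- by move=> _ _ [v t _]; rewrite !big_cons big_nil /= !addr0 addrC.
Qed.

Definition expo w x : int := word_expo w (repr x).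

Lemma expo_class w u : expo w (word_class u) = word_expo w u.
Proof. exact/word_expo_congr/presented_reprP. Qed.

Lemma expoM w x y : expo w (x * y)%g = expo w x + expo w y.
Proof.
rewrite -[x]word_class_repr -[y]word_class_repr word_classM !expo_class.
exact: big_cat.
Qed.

Lemma expo_gen w v : expo w (gen v) = (v == w)%:R.
Proof. by rewrite expo_class /word_expo big_seq1 /=; case: eqP. Qed.

Lemma expo1 w : expo w 1%g = 0.
Proof. by rewrite (expo_class w [::]) /word_expo big_nil. Qed.

(** The values F v are arbitrary, so this recursion also serves for maps that
are additive only up to an error term ([increment_expo]). *)
Lemma expo_sum_gen (B : zmodType) (F : Gamma -> B) v x :
  \sum_u F u *~ expo u (gen v * x)%g = F v + \sum_u F u *~ expo u x.
Proof.
transitivity (\sum_u (F u *~ (v == u)%:R + F u *~ expo u x)).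
  by apply: eq_bigr => u _; rewrite expoM expo_gen mulrzDr.
rewrite big_split /=; congr (_ + _).
rewrite (bigD1 v) //= eqxx big1 ?addr0 // => u neq_uv.
by rewrite eq_sym (negPf neq_uv).
Qed.

Lemma raag_additive (B : zmodType) (f : A -> B) :
    (forall x y, f (x * y)%g = f x + f y) ->
  forall x, f x = \sum_v f (gen v) *~ expo v x.
Proof.
move=> fM; elim/raag_ind => [|v x IH|v x IH].
- have f1 : f 1%g = 0 by apply: (addrI (f 1%g)); rewrite -fM mulg1 addr0.
  by rewrite f1 big1 // => u _; rewrite expo1.
- by rewrite fM IH expo_sum_gen.
- by apply: (addrI (f (gen v))); rewrite -expo_sum_gen -fM mulVKg.
Qed.

Lemma expo_morph (h : A -> A) : {morph h : x y / (x * y)%g} -> forall w x,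
  expo w (h x) = \sum_u expo w (h (gen u)) * expo u x.
Proof.
move=> hM w x; rewrite -[LHS]/((expo w \o h) x) (raag_additive (f := expo w \o h)) /=.
  by apply: eq_bigr => u _; rewrite -mulrzr intz.
by move=> y z; rewrite hM expoM.
Qed.

Lemma expo_conj w x y : expo w (x ^ y)%g = expo w x.
Proof.
have expoV : expo w y^-1%g + expo w y = 0.
  by rewrite -expoM mulVg expo1.
by rewrite conjgE !expoM addrCA expoV addr0.
Qed.

Section Cocycle.
Variables (w w' : Gamma).
Hypothesis nadj_ww' : ~~ edge w w'.

Let pair_test (t : seq Gamma) : int := (t == [:: w; w'])%:R.
Let single_test (t : seq Gamma) : int := (t == [:: w'])%:R.

Lemma pair_testP : trace_form 3 pair_test.
Proof.
split=> [s t v u vu|t]; last first.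
  by case: t => [|? [|? [|? ?]]] //; rewrite /pair_test !eqseq_cons !andbF.
rewrite /pair_test; congr (nat_of_bool _)%:R.
case: s => [|x [|y s]] /=; last by rewrite !eqseq_cons; case: s => [|? ?];
  rewrite !andbF.
  rewrite !eqseq_cons; case: t => [|? ?]; rewrite /= ?andbF // !andbT.
  apply/andP/andP => -[/eqP e1 /eqP e2]; move: vu; rewrite e1 e2.
    by rewrite (negPf nadj_ww').
  by rewrite edge_sym (negPf nadj_ww').
by rewrite !eqseq_cons !andbF.
Qed.

Lemma single_testP : trace_form 2 single_test.
Proof.
split=> [s t v u vu|t]; last first.
  by case: t => [|? [|? ?]] //; rewrite /single_test !eqseq_cons !andbF.
rewrite /single_test; congr (nat_of_bool _)%:R.
by case: s => [|x [|y s]] /=; rewrite !eqseq_cons ?andbF.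
Qed.

Lemma coef_single N x : (1 < N)%N -> coef N x single_test = expo w' x.
Proof.
move=> N2; have tN := trace_form_leq N2 single_testP.
have step v y : coef N (gen v * y)%g single_test
    = (v == w')%:R + coef N y single_test.
  rewrite coefM // /coef magnus_gen; last exact: trace_form_magnus.
  rewrite addrC; congr (_ + _); rewrite (magnus_top (N := 1)) //.
  - by rewrite /single_test eqseq_cons andbT.
  - exact: ltnW.
  - exact: single_testP.
elim/raag_ind: x => [|v y IH|v y IH].
- by rewrite {1}/coef magnus1 // expo1.
- by rewrite step IH expoM expo_gen.
- apply: (addrI ((v == w')%:R)).
  by rewrite -step -[in RHS]expo_gen -expoM !mulVKg.
Qed.

Lemma coef_pair_gen v y : coef 3 (gen v * y)%g pair_test
  = coef 3 y pair_test + (v == w)%:R * expo w' y.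
Proof.
have tp := pair_testP; rewrite coefM // /coef magnus_gen;
  last exact: trace_form_magnus.
congr (_ + _); rewrite magnus_coef -(@coef_single 3) //.
have -> : shiftl [:: v] pair_test = fun t => (v == w)%:R * single_test t.
  apply/funext => t; rewrite /shiftl /pair_test /single_test /= eqseq_cons.
  by case: (v == w); rewrite ?mul1r ?mul0r.
by rewrite /coef magnusZ.
Qed.

(** When w and w' are not adjacent, the coefficient of the monomial w w' is well
defined. Its defect of additivity is the product of exponent sums, from which
the symmetry for commuting elements follows ([expo_commute]). *)
Lemma coef_pairM x y : coef 3 (x * y)%g pair_test =
  coef 3 x pair_test + coef 3 y pair_test + expo w x * expo w' y.
Proof.
elim/raag_ind: x => [|v z IH|v z IH].
- rewrite mul1g {2}/coef magnus1; last exact: pair_testP.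
  rewrite expo1 mul0r addr0.
  by rewrite /pair_test add0r.
- rewrite -mulgA !coef_pair_gen IH !expoM expo_gen; ring.
- set t := (_ * z)%g.
  have zE : z = (gen v * t)%g by rewrite /t mulVKg.
  apply: (addIr ((v == w)%:R * expo w' (t * y)%g)).
  rewrite -coef_pair_gen mulgA -zE IH zE coef_pair_gen !expoM expo_gen; ring.
Qed.

Lemma expo_commute x y : commute x y ->
  expo w x * expo w' y = expo w y * expo w' x.
Proof.
move=> xy; have := coef_pairM x y; rewrite xy coef_pairM.
by rewrite [X in X + _ = _]addrC => /addrI.
Qed.

End Cocycle.

End Exponents.

(** * Automorphisms acting on the first homology *)

Section Homology.
Local Open Scope ring_scope.
Variable Gamma : sgraph.
Local Notation A := (raag Gamma).
Implicit Types (v w : Gamma) (x y : A) (f g h : group_aut A).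

Definition aut_mx f v w : int := expo w (f (gen v)).

Lemma expo_aut f w x : expo w (f x) = \sum_u aut_mx f u w * expo u x.
Proof. exact: (expo_morph (@group_autM A f)). Qed.

Lemma aut_mxM f g v w : aut_mx (f * g)%g v w = \sum_u aut_mx g v u * aut_mx f u w.
Proof.
rewrite /aut_mx group_aut_mulE expo_aut.
by apply: eq_bigr => u _; rewrite mulrC.
Qed.

Lemma aut_mx1 v w : aut_mx 1%g v w = (v == w)%:R.
Proof. exact: expo_gen. Qed.

(** An edge-preserving bijection of a finite graph also reflects edges, since it
permutes the finite set of edges. *)
Lemma asymmetric_rigid (s : 'S_#|Gamma|) : asymmetric Gamma ->
  (forall i j, edge (enum_val i) (enum_val j) ->
     edge (enum_val (s i)) (enum_val (s j))) -> s = 1%g.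
Proof.
move=> asym s_edge.
pose p v := enum_val (s (enum_rank v)).
have p_inj : injective p.
  by move=> v w /enum_val_inj /perm_inj /enum_rank_inj.
have p_edge v w : edge v w -> edge (p v) (p w).
  by move=> vw; apply: s_edge; rewrite !enum_rankK.
pose E := [set e : Gamma * Gamma | edge e.1 e.2].
pose pp (e : Gamma * Gamma) := (p e.1, p e.2).
have pp_inj : injective pp.
  by move=> [a b] [a' b'] [/p_inj -> /p_inj ->].
have EE : pp @: E = E.
  apply/eqP; rewrite eqEcard card_imset // leqnn andbT.
  by apply/subsetP => _ /imsetP[[a b] ab ->]; move: ab; rewrite !inE;
    exact: p_edge.
have : perm p_inj \in graph_aut Gamma.
  rewrite inE; apply/'forall_'forall_eqP => v w; rewrite !permE.
  apply/idP/idP; last exact: p_edge.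
  move=> pvw; have : (p v, p w) \in pp @: E by rewrite EE inE.
  by case/imsetP=> [[a b]]; rewrite inE /= => ab [/p_inj -> /p_inj ->].
rewrite asym inE => /eqP/permP p1; apply/permP => i; rewrite perm1.
by apply: enum_val_inj; have := p1 (enum_val i);
  rewrite permE perm1 /p enum_valK.
Qed.

Lemma aut_triangular : asymmetric Gamma -> exists deg : Gamma -> nat,
  forall f v w, aut_mx f v w != 0 -> v = w \/ (deg v < deg w)%N.
Proof.
move=> asym; pose adj : rel 'I_#|Gamma| := fun i j => edge (enum_val i) (enum_val j).
pose deg (i : 'I_#|Gamma|) := #|[set u | (u == i) || adj i u]|.
exists (deg \o enum_rank) => f v w fvw.
pose mx g : 'M[rat]_#|Gamma| := \matrix_(i < #|Gamma|, j < #|Gamma|)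
   (aut_mx g (enum_val i) (enum_val j))%:~R.
have mxM g h : mx (g * h)%g = mx h *m mx g.
  apply/matrixP => i j; rewrite !mxE aut_mxM rmorph_sum /=.
  rewrite (reindex_onto enum_val enum_rank) /=; last by move=> u _;
    rewrite enum_rankK.
  apply: eq_big => k; first by rewrite enum_valK eqxx.
  by move=> _; rewrite !mxE rmorphM.
have f_unit : mx f \in unitmx.
  have [] // := @mulmx1_unit _ _ (mx f) (mx f^-1%g).
  rewrite -mxM mulVg; apply/matrixP => i j.
  by rewrite !mxE aut_mx1 (inj_eq enum_val_inj) -mulrz_nat; case: eqP.
have adj_sym : symmetric adj by move=> i j; rewrite /adj edge_sym.
have adj_irr : irreflexive adj by move=> i; rewrite /adj edge_irr.
have f_adj i i' j j' : adj i i' -> ~~ adj j j' ->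
    mx f i j * mx f i' j' = mx f i j' * mx f i' j.
  move=> ii' njj'; rewrite !mxE -!intrM; congr (_%:~R).
  rewrite [RHS]mulrC; apply: expo_commute => //.
  by rewrite /commute -!group_autM gen_commute.
have := rigid_triangular adj_sym adj_irr
  (fun s => asymmetric_rigid asym) f_unit f_adj (v := enum_rank v) (w := enum_rank w).
by rewrite mxE !enum_rankK intr_eq0 => /(_ fvw) [/enum_rank_inj|]; [left|right].
Qed.

Hypothesis asym : asymmetric Gamma.

(** An intermediate vertex between v and v would need a degree both larger and
smaller than that of v. *)
Lemma aut_diagM f g v : aut_mx (f * g)%g v v = aut_mx f v v * aut_mx g v v.
Proof.
have [deg tri] := aut_triangular asym.
rewrite aut_mxM (bigD1 v) //= big1 ?addr0 1?mulrC // => u /eqP neq_uv.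
have [->|/tri[/esym//|lt_vu]] := eqVneq (aut_mx g v u) 0;
  first by rewrite mul0r.
have [->|/tri[//|lt_uv]] := eqVneq (aut_mx f u v) 0; first by rewrite mulr0.
by have := ltn_trans lt_vu lt_uv; rewrite ltnn.
Qed.

Lemma aut_diagR f g v : aut_mx [~ f, g]%g v v = 1.
Proof.
have diagV h : aut_mx h^-1%g v v * aut_mx h v v = 1.
  by rewrite -aut_diagM mulVg aut_mx1 eqxx.
by rewrite commgEl conjgE !aut_diagM mulrA mulrACA !diagV mulr1.
Qed.

(** Off-diagonal entries vanish by induction on the difference of degrees: the
(v, w) entry of the square is twice that of f, plus products of entries with
smaller difference, and integers have no 2-torsion. *)
Lemma unipotent_involution f : (forall v, aut_mx f v v = 1) ->
    (forall w x, expo w (f (f x)) = expo w x) ->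
  forall w x, expo w (f x) = expo w x.
Proof.
move=> diag1 ff; have [deg tri] := aut_triangular asym.
suff off k v w : (deg w - deg v < k)%N -> v != w -> aut_mx f v w = 0.
  move=> w x; rewrite expo_aut (bigD1 w) //= diag1 mul1r big1 ?addr0 // => u neq.
  by rewrite (off (deg w - deg u).+1) ?mul0r.
elim: k v w => // k IHk v w ltk neq_vw.
have := ff w (gen v); rewrite expo_aut expo_gen (negPf neq_vw).
rewrite (bigD1 v) //= (bigD1 w) /=; last by rewrite eq_sym.
rewrite diag1 mul1r -!/(aut_mx _ _ _) diag1 mulr1 big1; last first.
  move=> u /andP[/eqP uv /eqP uw]; have [->|nz1] := eqVneq (aut_mx f u w) 0.
    by rewrite mul0r.
  have [->|nz2] := eqVneq (expo u (f (gen v))) 0; first by rewrite mulr0.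
  have lt_uw : (deg u < deg w)%N by case: (tri _ _ _ nz1).
  have lt_vu : (deg v < deg u)%N by case: (tri _ _ _ nz2) => // /esym.
  by rewrite (IHk u w) ?mul0r //; [lia | exact/eqP].
by rewrite addr0; lia.
Qed.

End Homology.

(** * Polynomial functions and unipotent endomorphisms *)

Section Polynomial.
Local Open Scope ring_scope.
Variables (Gamma : sgraph) (B : comNzRingType).
Local Notation A := (raag Gamma).
Implicit Types (f g : A -> B) (x y a b : A) (h : A -> A).

Definition increment a f x : B := f (x * a)%g - f x.

(** Polynomial functions of degree less than n: those killed by n successive
increments. *)
Fixpoint poly_fun n f : Prop :=
  if n is n'.+1 then forall a, poly_fun n' (increment a f) else forall x, f x = 0.

Lemma poly_fun_eq n f g : f =1 g -> poly_fun n f -> poly_fun n g.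
Proof. by move/funext->. Qed.

Lemma poly_fun0 n : poly_fun n (fun=> 0).
Proof.
elim: n => //= n IHn a; apply: poly_fun_eq IHn => x.
by rewrite /increment subrr.
Qed.

Lemma poly_funD n f g : poly_fun n f -> poly_fun n g -> poly_fun n (f \+ g).
Proof.
elim: n f g => [|n IHn] f g pf pg; first by move=> x /=; rewrite pf pg addr0.
move=> a; apply: poly_fun_eq (IHn _ _ (pf a) (pg a)) => x.
by rewrite /increment /= opprD addrACA.
Qed.

Lemma poly_funN n f : poly_fun n f -> poly_fun n (\- f).
Proof.
elim: n f => [|n IHn] f pf; first by move=> x /=; rewrite pf oppr0.
by move=> a; apply: poly_fun_eq (IHn _ (pf a)) => x;
  rewrite /increment /= opprD.
Qed.

Lemma poly_funB n f g : poly_fun n f -> poly_fun n g -> poly_fun n (f \- g).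
Proof. by move=> pf pg; apply: poly_funD pf (poly_funN pg). Qed.

Lemma poly_fun_morph h n f : {morph h : x y / (x * y)%g} ->
  poly_fun n f -> poly_fun n (f \o h).
Proof.
move=> hM; elim: n f => [|n IHn] f pf; first by move=> x /=.
move=> a; apply: poly_fun_eq (IHn _ (pf (h a))) => x.
by rewrite /increment /= hM.
Qed.

(** The defect of additivity of increments is a second increment. *)
Lemma increment_mul n f a b : poly_fun n.+2 f ->
  poly_fun n (increment (a * b)%g f \- increment a f \- increment b f).
Proof.
move=> pf; apply: poly_fun_eq (pf b a) => x; rewrite /increment /= mulgA; ring.
Qed.

(** Modulo functions of degree lower by two, the increment of f is additive in
the step by [increment_mul], so it depends only on the exponent sums of the
step. *)
Lemma increment_expo n f a b : (forall w, expo w a = expo w b) ->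
  poly_fun n.+2 f -> poly_fun n (increment a f \- increment b f).
Proof.
move=> eq_ab pf; pose L a x := \sum_v increment (gen v) f x *~ expo v a.
have L_gen v y x : L (gen v * y)%g x = increment (gen v) f x + L y x.
  exact: (expo_sum_gen (fun v => increment (gen v) f x)).
have diff a' : poly_fun n (increment a' f \- L a').
  elim/raag_ind: a' => [|v y IH|v y IH].
  - suff E : (fun=> 0) =1 increment 1%g f \- L 1%g.
      by apply: poly_fun_eq E _; exact: poly_fun0.
    move=> x; rewrite /= /L big1 => [|v _]; last by rewrite expo1.
    by rewrite /increment mulg1 subrr subr0.
  - apply: poly_fun_eq (poly_funD (increment_mul (gen v) y pf) IH) => x /=.
    rewrite L_gen; ring.
  - set z := (_ * y)%g in IH *; have yE : y = (gen v * z)%g by rewrite /z mulVKg.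
    apply: poly_fun_eq (poly_funB IH (increment_mul (gen v) z pf)) => x /=.
    rewrite [in LHS]yE L_gen; ring.
have Lab : L a = L b.
  by apply/funext => x; apply: eq_bigr => v _; rewrite eq_ab.
apply: poly_fun_eq (poly_funB (diff a) (diff b)) => x /=.
rewrite Lab; ring.
Qed.

(** The increment of f along h a differs from the one along a by a function of
lower degree, by [increment_expo]. *)
Lemma poly_fun_unipotent h n f : {morph h : x y / (x * y)%g} ->
    (forall w x, expo w (h x) = expo w x) ->
  poly_fun n.+1 f -> poly_fun n (f \o h \- f).
Proof.
move=> hM hE; elim: n f => [|n IHn] f pf.
  by move=> x /=; rewrite -[h x](mulVKg x); exact: pf.
move=> a; have pd := poly_fun_morph hM (increment_expo (hE^~ a) pf).
apply: poly_fun_eq (poly_funD pd (IHn _ (pf a))) => x.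
rewrite /increment /= hM; ring.
Qed.

Lemma iter_expo h n : (forall w x, expo w (h x) = expo w x) ->
  forall w x, expo w (iter n h x) = expo w x.
Proof. by move=> hE w x; elim: n => //= n <-. Qed.

Lemma iter_morph h n : {morph h : x y / (x * y)%g} ->
  {morph iter n h : x y / (x * y)%g}.
Proof. by move=> hM x y; elim: n => //= n ->. Qed.

(** If d = h^(3^r) fixes all functions of degree less than n, then it adds to a
function f of degree n a function that d itself fixes; so d^(3^m) adds 3^m
times this function, which is 0. *)
Lemma poly_fun_period h m n : {morph h : x y / (x * y)%g} ->
    (forall w x, expo w (h x) = expo w x) -> (forall b : B, b *+ 3 ^ m = 0) ->
  exists r, forall f, poly_fun n f -> forall x, f (iter (3 ^ r) h x) = f x.
Proof.
move=> hM hE B3; elim: n => [|n [r IHn]]; first by exists 0 => f pf x;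
  rewrite !pf.
exists (m + r)%N => f pf x; pose d := iter (3 ^ r) h.
have pg := poly_fun_unipotent (iter_morph (3 ^ r) hM) (iter_expo (3 ^ r) hE) pf.
have step i : f (iter i d x) = f x + (f (d x) - f x) *+ i.
  have gd y : f (d (d y)) - f (d y) = f (d y) - f y by exact: (IHn _ pg y).
  have gj j : f (d (iter j d x)) - f (iter j d x) = f (d x) - f x.
    by elim: j => //= j IHj; rewrite gd.
  elim: i => [|i IHi]; first by rewrite addr0.
  rewrite mulrSr addrA -IHi -(gj i) /=; ring.
by rewrite expnD iterM step B3 addr0.
Qed.

End Polynomial.

Section Approximation.
Local Open Scope ring_scope.
Variables (Gamma : sgraph) (K : comNzRingType) (m : nat).
Local Notation A := (raag Gamma).
Hypothesis K3 : (3 ^ m)%:R = 0 :> K.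

(** Acting by a - 1 lowers the degree in which a form is truncated, by
[magnus_top]. *)
Lemma coef_poly_fun N n (phi : seq Gamma -> K) : (n <= N)%N -> trace_form n phi ->
  poly_fun n (fun x : A => coef N x phi).
Proof.
elim: n phi => [|n IHn] phi nN tp.
  by move=> x; have [_ top] := trace_form_magnus N x tp; exact: top.
move=> a; have t' : trace_form n (magnus N a phi \+ (fun t => -1 * phi t)).
  have [inv _] := trace_formD (trace_form_magnus N a tp) (trace_formZ (-1) tp).
  split=> // t nt; rewrite /= (magnus_top (N := n)) ?mulN1r ?subrr //.
  by apply: leq_trans nN.
apply: poly_fun_eq (IHn _ (ltnW nN) t') => x.
rewrite /increment coefM; last exact: trace_form_leq tp.
by rewrite /coef magnusD magnusZ /= mulN1r.
Qed.

Lemma unipotent_period N (h : A -> A) : {morph h : x y / (x * y)%g} ->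
    (forall w x, expo w (h x) = expo w x) ->
  exists r, forall x, magnus_eq K N (iter (3 ^ r) h x) x.
Proof.
move=> hM hE; have K3' (b : K) : b *+ 3 ^ m = 0 by rewrite -mulr_natr K3 mulr0.
have [r rP] := poly_fun_period N hM hE K3'.
by exists r => x phi tp; apply: (rP _ (coef_poly_fun (leqnn N) tp)).
Qed.

(** By [unipotent_period] the power of c with odd exponent 3^r = 2 j + 1 is
approximately trivial, while its even part is conjugation by g^j. *)
Lemma involution_approx N (c : A -> A) (g : A) : {morph c : x y / (x * y)%g} ->
    (forall w x, expo w (c x) = expo w x) -> (forall x, c (c x) = (x ^ g)%g) ->
  exists j, forall x, magnus_eq K N (c x ^ (g ^+ j))%g x.
Proof.
move=> cM cE cc; have [r rP] := unipotent_period N cM cE.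
have even_iter j x : iter j.*2 c x = (x ^ (g ^+ j))%g.
  elim: j => [|j IHj]; first by rewrite conjg1.
  by rewrite doubleS !iterS cc IHj -conjgM -expgSr.
exists (3 ^ r)./2 => x; have := rP x.
by rewrite -{1}[(3 ^ r)%N]odd_double_half oddX orbT iterSr even_iter.
Qed.

End Approximation.

(** * Cyclically reduced products and class functions *)

Section ClassFunctions.
Local Open Scope ring_scope.
Variables (Gamma : sgraph) (K : comNzRingType).
Local Notation A := (raag Gamma).
Implicit Types (phi : seq Gamma -> K) (x y : A).

(** A form invariant under rotation of words is a trace on the truncated
algebra. *)
Lemma coef_conj N phi x y : trace_form N phi ->
    (forall v t, phi (v :: t) = phi (rcons t v)) ->
  coef N (x ^ y)%g phi = coef N x phi.
Proof.
move=> tp cyc.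
have swap v z : coef N (gen v * z)%g phi = coef N (z * gen v)%g phi.
  rewrite !coefM //.
  have -> : magnus N (gen v) phi = phi \+ shiftl [:: v] phi.
    by apply/funext => t; rewrite magnus_gen // /shiftl /= cyc.
  rewrite {2}/coef magnusD /= magnus_shiftl cats0.
  by rewrite /coef magnus_gen //; exact: trace_form_magnus.
elim/raag_ind: y x => [|v y IHy|v y IHy] x; rewrite ?conjg1 // conjgM IHy.
  by rewrite conjgE mulgA -swap mulVKg.
rewrite conjgE invgK swap.
by rewrite -mulgA mulVg mulg1.
Qed.

End ClassFunctions.

Section Syllables.
Local Open Scope group_scope.
Variable Gamma : sgraph.
Local Notation A := (raag Gamma).
Implicit Types (v w : Gamma) (x h : A) (s t a b : seq Gamma).

Local Notation syllable := (Gamma * (nat * nat))%type.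
Implicit Types (y z : syllable) (l : seq syllable).

(** In a syllable (v, (p, q)), the pair of natural numbers (p, q) encodes the
integer exponent p - q of v. *)
Definition syl_val (y : syllable) : A := gen y.1 ^+ y.2.1 * gen y.1 ^- y.2.2.
Arguments syl_val : simpl never.
Definition syl_expo (y : syllable) : int := (y.2.1%:Z - y.2.2%:Z)%R.
Definition syls_val l : A := foldr (fun y x => syl_val y * x) 1 l.
Definition support_word l : seq Gamma := map fst l.

Lemma syls_val_cat l l' : syls_val (l ++ l') = syls_val l * syls_val l'.
Proof. by elim: l => [|y l IHl]; rewrite /= ?mul1g // IHl mulgA. Qed.

Lemma syl_val_commute (y z : syllable) : commute (gen y.1) (gen z.1) ->
  commute (syl_val y) (syl_val z).
Proof.
have comm (u u' : A) p q p' q' : commute u u' ->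
    commute (u ^+ p * u ^- q) (u' ^+ p' * u' ^- q').
  move=> uu'; have half r r' : commute (u ^+ r) (u' ^+ r') by exact: commuteX2.
  have one r : commute (u ^+ r) (u' ^+ p' * u' ^- q').
    by apply: commuteM; [exact: half | exact/commuteV/half].
  apply: commute_sym; apply: commuteM; first exact/commute_sym/one.
  exact/commuteV/commute_sym/one.
exact: comm.
Qed.

Lemma syl_val_merge v p q p' q' :
  syl_val (v, (p, q)) * syl_val (v, (p', q')) = syl_val (v, (p + p', q + q')).
Proof.
rewrite /syl_val /= !expgnDr invgM.
have c r r' : commute (gen v ^+ r) (gen v ^- r').
  by apply: commuteV; apply: commuteX2.
have c' : gen v ^- q * gen v ^+ p' = gen v ^+ p' * gen v ^- q by rewrite c.
have c'' : commute (gen v ^- q) (gen v ^- q').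
  by apply/commuteV/commute_sym/c.
by rewrite -!mulgA; congr (_ * _); rewrite !mulgA c' -!mulgA; congr (_ * _).
Qed.

(** Conjugacy in the partially commutative monoid. *)
Inductive cyc_equiv s : seq Gamma -> Prop :=
| cyc_refl : cyc_equiv s s
| cyc_swap a v w b : edge v w ->
    cyc_equiv s (a ++ v :: w :: b) -> cyc_equiv s (a ++ w :: v :: b)
| cyc_rot v t : cyc_equiv s (v :: t) -> cyc_equiv s (rcons t v)
| cyc_unrot v t : cyc_equiv s (rcons t v) -> cyc_equiv s (v :: t).

Lemma cyc_equiv_perm s t : cyc_equiv s t -> perm_eq s t.
Proof.
elim=> // {t} [a v w b _ _|v t _|v t _] /perm_trans; apply.
- by rewrite perm_cat2l; apply/seq.permP => P /=; rewrite addnCA.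
- by rewrite perm_sym perm_rcons.
- by rewrite perm_rcons.
Qed.

Lemma cyc_equiv_size s t : cyc_equiv s t -> size t = size s.
Proof. by move/cyc_equiv_perm/perm_size. Qed.

Lemma support_word_catP l a b : support_word l = a ++ b ->
  exists l1 l2, [/\ l = l1 ++ l2, support_word l1 = a & support_word l2 = b].
Proof.
elim: a l => [|v a IHa] l /=; first by exists [::], l.
by case: l => // y l [<- /IHa[l1 [l2 [-> <- <-]]]]; exists (y :: l1), l2.
Qed.

(** Swaps and rotations of the word of vertices are realized by swaps and
rotations of the syllables, which conjugate the product. *)
Lemma cyc_equiv_lift l s : cyc_equiv (support_word l) s ->
  exists l' h, support_word l' = s /\ syls_val l' = syls_val l ^ h.
Proof.
elim=> {s} [|a v w b vw _ [l' [h [sl' vl']]]|v t _ [l' [h [sl' vl']]]|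
            v t _ [l' [h [sl' vl']]]].
- by exists l, 1; rewrite conjg1.
- have [l1 [l2 [e1 <-]]] := support_word_catP sl'; rewrite {}e1 in vl' *.
  case: l2 vl' => [|y [|z l2]] // vl' [yv zw <-].
  exists (l1 ++ z :: y :: l2), h; split.
    by rewrite /support_word map_cat /= yv zw.
  rewrite -vl' !syls_val_cat /=; congr (_ * _); rewrite [LHS]mulgA [RHS]mulgA;
    congr (_ * _).
  suff : commute (syl_val z) (syl_val y) by [].
  by apply: syl_val_commute; rewrite yv zw; exact/commute_sym/gen_commute.
- case: l' sl' vl' => // y l' [<- <-] vl'.
  exists (rcons l' y), (h * syl_val y); split;
    first by rewrite /support_word map_rcons.
  by rewrite conjgM -vl' -cats1 syls_val_cat /= mulg1 conjgE -(mulgA (syl_val y)) mulKg.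
- move: sl'; rewrite -cats1 => /support_word_catP[l1 [l2 [e1 <-]]].
  rewrite {}e1 in vl'.
  case: l2 vl' => [|y [|]] // vl' [<-].
  exists (y :: l1), (h * (syl_val y)^-1); split=> //.
  by rewrite conjgM -vl' syls_val_cat /= mulg1 conjgE invgK mulgK.
Qed.

Definition square_free s := forall a v b, s <> a ++ v :: v :: b.

(** The second condition says that no two syllables on the same vertex can be
brought side by side by swaps and rotations. *)
Definition cyc_reduced l := all (fun y => syl_expo y != 0%R) l /\
  forall s, cyc_equiv (support_word l) s -> square_free s.

(** A product with the least number of syllables in its conjugacy class is
reduced: a trivial syllable could be removed, and two neighbouring syllables on
the same vertex could be merged. *)
Lemma cyc_reduced_exists l :
  exists l' h, cyc_reduced l' /\ syls_val l' = syls_val l ^ h.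
Proof.
have [n] := ubnP (size l); elim: n l => // n IHn l; rewrite ltnS => ln.
have shorter l' h : (size l' < size l)%N -> syls_val l' = syls_val l ^ h ->
    exists l' h, cyc_reduced l' /\ syls_val l' = syls_val l ^ h.
  move=> l'l vl'; have [l'' [h' [red vl'']]] := IHn l' (leq_trans l'l ln).
  by exists l'', (h * h'); rewrite conjgM -vl'.
have [all_nz|] := boolP (all (fun y => syl_expo y != 0%R) l); last first.
  case/allPn=> [[v [p q]] yl]; rewrite negbK subr_eq0 => /eqP[epq].
  move: yl shorter; case/splitPr => l1 l2 /(_ (l1 ++ l2) 1); apply.
    by rewrite !size_cat /= addnS.
  by rewrite conjg1 !syls_val_cat /= /syl_val /= epq mulgV mul1g.
have [[s [ls [v [a [b sE]]]]]|no_sq] := pselect (exists s,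
    cyc_equiv (support_word l) s /\ exists v a b, s = a ++ v :: v :: b);
      last first.
  exists l, 1; rewrite conjg1; split=> //; split=> // s ls a v b sE.
  by apply: no_sq; exists s; split=> //; exists v, a, b.
have [l' [h [sl' vl']]] := cyc_equiv_lift ls.
have size_l' : size l' = size l.
  by rewrite -[LHS](size_map fst) -[RHS](size_map fst) -(cyc_equiv_size ls) -sl'.
rewrite sE in sl'; have [l1 [l2 [e1 _]]] := support_word_catP sl'.
case: l2 e1 => [|[v1 [p q]] [|[v2 [p' q']] l2]] //= e1 [e2 e3 _].
apply: (shorter (l1 ++ (v, (p + p', q + q')%N) :: l2) h).
  by rewrite -size_l' e1 !size_cat /= !addnS.
by rewrite -vl' e1 !syls_val_cat /= -syl_val_merge e2 e3 -mulgA.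
Qed.

Section Leading.
Local Open Scope ring_scope.
Variable K : comNzRingType.
Implicit Types (phi psi : seq Gamma -> K).

Lemma magnus_gen_linear N v p psi : trace_form N psi ->
    (forall t, psi (rcons (rcons t v) v) = 0) ->
  magnus N (gen v ^+ p)%g psi = psi \+ (fun t => p%:R * shiftr v psi t).
Proof.
move=> tp sq; elim: p => [|p IHp].
  by rewrite magnus1 //; apply/funext => t /=; rewrite mul0r addr0.
rewrite expgS magnusM // IHp magnusD magnusZ; apply/funext => t /=.
rewrite !magnus_gen //; last exact: trace_form_shiftr.
rewrite /shiftr sq mulrS; ring.
Qed.

Lemma magnus_syl_linear N (y : syllable) psi : trace_form N psi ->
    (forall t, psi (rcons (rcons t y.1) y.1) = 0) ->
  magnus N (syl_val y) psi =
    psi \+ (fun t => (syl_expo y)%:~R * shiftr y.1 psi t).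
Proof.
case: y => v [p q] /= tp sq; rewrite /syl_val /syl_expo /=.
pose chi := psi \+ (fun t => - q%:R * shiftr v psi t).
have tc : trace_form N chi by exact: trace_formD tp (trace_formZ _ (trace_form_shiftr v tp)).
have sqc t : chi (rcons (rcons t v) v) = 0.
  by rewrite /chi /shiftr /= !sq mulr0 addr0.
transitivity (magnus N (gen v ^+ p)%g chi).
  rewrite magnusM //; congr (magnus _ _ _).
  have -> : psi = magnus N (gen v ^+ q)%g chi.
    rewrite magnus_gen_linear //; apply/funext => t.
    rewrite /chi /shiftr /= sq; ring.
  by rewrite -magnusM // mulVg magnus1.
rewrite magnus_gen_linear //; apply/funext => t.
rewrite /chi /shiftr /= sq intrB; ring.
Qed.

(** As phi vanishes on squares, a syllable with exponent e acts as 1 + e v. On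
forms vanishing in degree less than n, the only term that survives takes one
letter from each syllable. *)
Lemma magnus_leading N l phi n : trace_form N phi ->
    (forall t, (size t < n)%N -> phi t = 0) ->
    (forall a v b, phi (a ++ v :: v :: b) = 0) ->
  let psi := magnus N (syls_val l) phi in
  [/\ forall a v b, psi (a ++ v :: v :: b) = 0,
      forall t, (size t + size l < n)%N -> psi t = 0
    & forall t, (size t + size l)%N = n ->
        psi t = (\prod_(y <- l) (syl_expo y)%:~R) * phi (t ++ support_word l)].
Proof.
move=> tp low sq; elim: l => [|y l IHl] /=.
  rewrite magnus1 //; split=> // t; first by rewrite addn0; exact: low.
  by rewrite big_nil mul1r cats0.
rewrite magnusM //; move: IHl => /=; set psi := magnus N (syls_val l) phi.
move=> [sq1 low1 top1]; have tpsi : trace_form N psi by exact: trace_form_magnus.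
have sqr t : psi (rcons (rcons t y.1) y.1) = 0.
  by rewrite -!cats1 -catA; exact: sq1.
rewrite magnus_syl_linear //; split=> /= [a v b|t st|t st].
- by rewrite /shiftr rcons_cat /= !sq1 mulr0 addr0.
- by rewrite /shiftr !low1 ?mulr0 ?addr0 ?size_rcons //; lia.
- rewrite low1 ?add0r; last by lia.
  by rewrite /shiftr top1 ?size_rcons ?big_cons ?cat_rcons ?mulrA //; lia.
Qed.

End Leading.

Section Detect.
Local Open Scope ring_scope.
Variables (K : comNzRingType) (l : seq syllable).
Hypothesis l_red : cyc_reduced l.

(** The trace detecting the cyclic word of l. *)
Definition cyc_test (t : seq Gamma) : K := `[< cyc_equiv (support_word l) t >]%:R.

Lemma cyc_test_form : trace_form (size l).+1 cyc_test.
Proof.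
split=> [s t v w vw|t lt]; rewrite /cyc_test.
  congr (nat_of_bool _)%:R; apply/asboolP/asboolP; apply: cyc_swap => //.
  by rewrite edge_sym.
case: asboolP => // /cyc_equiv_size E; move: lt.
by rewrite E size_map ltnn.
Qed.

Lemma cyc_test_rot v t : cyc_test (v :: t) = cyc_test (rcons t v).
Proof.
by congr (nat_of_bool _)%:R; apply/asboolP/asboolP;
  [exact: cyc_rot | exact: cyc_unrot].
Qed.

Lemma coef_cyc_test N : (size l < N)%N ->
  coef N (syls_val l) cyc_test = \prod_(y <- l) (syl_expo y)%:~R.
Proof.
move=> lN; have tp := trace_form_leq lN cyc_test_form.
have low t : (size t < size l)%N -> cyc_test t = 0.
  rewrite /cyc_test; case: asboolP => // /cyc_equiv_size ->.
  by rewrite size_map ltnn.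
have sq a v b : cyc_test (a ++ v :: v :: b) = 0.
  rewrite /cyc_test; case: asboolP => // E.
  by have [_ /(_ _ E a v b)] := l_red.
have [_ _ top] := magnus_leading l tp low sq.
rewrite /coef top //= /cyc_test asboolT ?mulr1 //; exact: cyc_refl.
Qed.

End Detect.

Lemma syls_val_surj x : exists l, x = syls_val l.
Proof.
elim/raag_ind: x => [|v x [l ->]|v x [l ->]]; first by exists [::].
  by exists ((v, (1%N, 0%N)) :: l); rewrite /= /syl_val /= invg1 mulg1.
by exists ((v, (0%N, 1%N)) :: l); rewrite /= /syl_val /= mul1g.
Qed.

(** The exponents of a reduced product may be divisible by any given power of 3,
so no single modulus detects that they are nonzero. *)
Lemma int_eq0_mod3 (z : int) : (forall m, z%:~R = 0 :> Z3 m)%R -> z = 0%R.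
Proof.
have nat0 (n : nat) : (forall m, n%:R = 0%R :> Z3 m)%R -> n = 0.
  move=> /(_ n) /(congr1 val); rewrite /= val_Zp_nat; last first.
    by rewrite -(expn0 3) ltn_exp2l.
  rewrite modn_small //; apply: leq_trans (_ : n < 3 ^ n) _ => //.
    exact: ltn_expl.
  by rewrite leq_exp2l.
case: z => n z0; first by rewrite (nat0 n).
have // : n.+1 = 0.
apply: nat0 => m; have := z0 m; rewrite NegzE mulrNz => /eqP.
by rewrite GRing.oppr_eq0 => /eqP.
Qed.

Lemma cyc_reduced_prod_neq0 l : cyc_reduced l ->
  (\prod_(y <- l) syl_expo y != 0)%R.
Proof. by move=> [/allP nz _]; rewrite prodf_seq_neq0; apply/allP. Qed.

(** If x is conjugate to a nonempty reduced product, the trace that detects its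
cyclic word takes the product of the exponents as value at x, and 0 at 1. *)
Theorem magnus_faithful x :
  (forall m N, magnus_eq (Z3 m) N.+1 x 1) -> x = 1.
Proof.
move=> x1; have [l0 xE] := syls_val_surj x.
have [l [h [red lE]]] := cyc_reduced_exists l0; rewrite -xE in lE.
case: l red lE => [|y l] red lE.
  by move/eqP: lE; rewrite /= eq_sym conjg_eq1 => /eqP.
have := cyc_reduced_prod_neq0 red; case/eqP; apply: int_eq0_mod3 => m.
have tp := cyc_test_form (Z3 m) (y :: l).
rewrite rmorph_prod -(coef_cyc_test _ red (ltnSn _)) lE.
rewrite coef_conj //; last exact: cyc_test_rot.
rewrite x1 // /coef magnus1 // /cyc_test; case: asboolP => // E.
by have := cyc_equiv_size E.
Qed.

(** Take a reduced product l conjugate to x; it is not empty, since v is not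
approximately trivial. The trace detecting the cyclic word of l is nonzero at x
for some m, hence at v; so this word is v alone, and then the exponent of the
only syllable is 1 modulo all powers of 3. *)
Theorem magnus_conj_gen x v :
    (forall m N, exists h, magnus_eq (Z3 m) N (x ^ h) (gen v)) ->
  exists h, x = gen v ^ h.
Proof.
move=> xv; have [l0 xE] := syls_val_surj x.
have [l [h [red lE]]] := cyc_reduced_exists l0; rewrite -xE in lE.
have prodE m N : (size l < N)%N -> (1 < N)%N -> ((\prod_(y <- l) syl_expo y)%:~R =
    cyc_test (Z3 m) l [::] + cyc_test (Z3 m) l [:: v] :> Z3 m)%R.
  move=> lN N1; have tp := trace_form_leq lN (cyc_test_form (Z3 m) l).
  rewrite rmorph_prod -(coef_cyc_test _ red lN) lE.
  have [h' xh] := xv m N.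
  rewrite coef_conj //; last exact: cyc_test_rot.
  rewrite -(@coef_conj _ _ _ _ x h') //; last exact: cyc_test_rot.
  by rewrite xh // /coef magnus_gen.
have l_nil : l <> [::].
  move=> l0'; have x1 : x = 1.
    by move/eqP: lE; rewrite l0' /= eq_sym conjg_eq1 => /eqP.
  have /(congr1 (expo v)) : gen v = 1.
    apply: magnus_faithful => m N; have [h'] := xv m N.+1.
    by rewrite x1 conj1g => /magnus_eq_sym.
  by rewrite expo_gen expo1 eqxx.
pose N := (size l).+2.
have nil0 m : cyc_test (Z3 m) l [::] = 0%R.
  rewrite /cyc_test; case: asboolP => // /cyc_equiv_size /esym/eqP.
  by rewrite size_map size_eq0 => /eqP.
have [v_eq|v_neq] := pselect (cyc_equiv (support_word l) [:: v]); last first.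
  have := cyc_reduced_prod_neq0 red; case/eqP; apply: int_eq0_mod3 => m.
  by rewrite (prodE m N) // nil0 /cyc_test asboolF // addr0.
have lv : support_word l = [:: v].
  by apply/perm_small_eq => //; exact: cyc_equiv_perm.
case: l lv {red l_nil v_eq} lE prodE nil0 {N} => [|[w [p q]] [|]] //= [->] lE prodE nil0.
have pq : p = q.+1.
  suff : (syl_expo (w, (p, q)) - 1 = 0)%R by rewrite /syl_expo /=; lia.
  apply: int_eq0_mod3 => m; have := prodE m 2 isT isT.
  rewrite big_seq1 nil0 /cyc_test /= asboolT; last exact: cyc_refl.
  by rewrite add0r => E; rewrite intrB E subrr.
exists h^-1; rewrite -[LHS](conjgK h) -lE /= mulg1 /syl_val /= pq.
by rewrite expgS mulgK.
Qed.

End Syllables.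

(** * Retractions and centralizers of generators *)

Section Retraction.
Local Open Scope group_scope.
Variable Gamma : sgraph.
Local Notation A := (raag Gamma).
Implicit Types (S T : pred Gamma) (v w : Gamma) (x y : A).

Definition retract_gen S v : A := if S v then gen v else 1.

Lemma retract_gen_commute S v w :
  edge v w -> commute (retract_gen S v) (retract_gen S w).
Proof.
move=> vw; rewrite /retract_gen; case: (S v); case: (S w); try exact: commute1.
  exact: gen_commute.
exact/commute_sym/commute1.
Qed.

Definition retract S : A -> A := raag_lift (retract_gen S).

Lemma retractM S : {morph retract S : x y / x * y}.
Proof. exact: raag_liftM (@retract_gen_commute S). Qed.

Lemma retract_genE S v : retract S (gen v) = if S v then gen v else 1.
Proof. exact: raag_lift_gen (@retract_gen_commute S) v. Qed.

Lemma retract_class S u :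
  retract S (word_class u) = word_class (filter (fun l => S l.1) u).
Proof.
rewrite /retract raag_liftE; last exact: retract_gen_commute.
elim: u => [//|[v b] u IHu] /=; rewrite IHu /retract_gen /=.
case: (S v); case: b => /=; rewrite ?invg1 ?mul1g //; first exact: word_classM.
by rewrite gen_inv word_classM.
Qed.

Lemma retract_comp S T x : retract S (retract T x) = retract (predI T S) x.
Proof.
rewrite -[x]word_class_repr !retract_class -filter_predI; congr word_class.
by apply: eq_filter => l /=; rewrite andbC.
Qed.

Lemma retract_T x : retract predT x = x.
Proof. by rewrite -[x]word_class_repr retract_class filter_predT. Qed.

Lemma eq_retract S T : S =1 T -> retract S =1 retract T.
Proof.
move=> ST x; rewrite -[x]word_class_repr !retract_class; congr word_class.
by apply: eq_filter => l; exact: ST.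
Qed.

Definition star v : pred Gamma := fun u => (u == v) || edge v u.

Lemma retract_central x y :
  commute (retract (fun u => [forall v, star v u]) x) y.
Proof.
set S := fun u => _; apply/commute_sym/(raag_commute (retractM S)) => v.
apply/commute_sym/(raag_commute (h := idfun)) => // w.
rewrite retract_genE; case: ifP => [/forallP/(_ w)|_].
  by case/predU1P => [->|/gen_commute/commute_sym].
exact/commute_sym/commute1.
Qed.

End Retraction.

Section Restriction.
Local Open Scope ring_scope.
Variables (Gamma : sgraph) (K : comNzRingType).
Local Notation A := (raag Gamma).
Implicit Types (phi psi : seq Gamma -> K) (s t : seq Gamma) (v w : Gamma) (x y : A).

(** The geometric series may be cut at any degree beyond that of the form. *)
Lemma magnus_index M N x phi : (N <= M)%N -> trace_form N phi ->
  magnus M x phi = magnus N x phi.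
Proof.
move=> NM tp; rewrite /magnus; elim: (repr x) => //= -[v b] u ->.
have [_ top] : trace_form N (word_act N u phi) by exact: trace_form_word.
apply/funext => t; rewrite /letter_act; case: b => //=.
rewrite [RHS](big_ord_widen M (fun k => (-1) ^+ k * word_act N u phi (t ++ nseq k v))) //.
rewrite [RHS]big_mkcond /=; apply: eq_bigr => k _; case: ltnP => // Nk.
by rewrite top ?mulr0 // size_cat size_nseq (leq_trans Nk) // leq_addl.
Qed.

Lemma magnus_eq_leq M N x y : (N <= M)%N ->
  magnus_eq K M x y -> magnus_eq K N x y.
Proof.
move=> NM xy phi tp; rewrite /coef -!(magnus_index _ NM tp).
exact: xy (trace_form_leq NM tp).
Qed.

Definition restrict (S : pred Gamma) phi t := if all S t then phi t else 0.

Lemma trace_form_restrict N S phi : trace_form N phi ->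
  trace_form N (restrict S phi).
Proof.
move=> [ip bp]; split=> [s t v w vw|t Nt]; rewrite /restrict; last first.
  by case: ifP => // _; exact: bp.
rewrite !all_cat /= !andbA -!(andbAC _ (S w)); case: ifP => // _.
exact: ip.
Qed.

Lemma word_act_supp N S u psi : (forall t, ~~ all S t -> psi t = 0) ->
  forall t, ~~ all S t -> word_act N u psi t = 0.
Proof.
move=> supp; elim: u => //= -[v b] u IHu t St; rewrite /letter_act.
have St' s : ~~ all S (t ++ s) by rewrite all_cat (negPf St).
case: b => /=; first by rewrite -cats1 !IHu ?addr0.
by rewrite big1 // => k _; rewrite IHu ?mulr0.
Qed.

(** Killing the generators outside S amounts to restricting linear forms to the
monomials in S. *)
Lemma coef_retract N S x phi : (0 < N)%N -> trace_form N phi ->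
  coef N (retract S x) phi = coef N x (restrict S phi).
Proof.
move=> N0 tp; rewrite -[x]word_class_repr retract_class /coef !magnus_class //;
  last exact: trace_form_restrict.
have supp t : ~~ all S t -> restrict S phi t = 0.
  by rewrite /restrict => /negPf->.
have : all S [::] by [].
elim: (repr x) [::] => [|[v b] u IHu] t /=; first by rewrite /restrict => ->.
move=> St; have [Sv|Sv] := boolP (S v).
  rewrite /= /letter_act; case: b => /=.
    by rewrite !IHu // all_rcons Sv.
  by apply: eq_bigr => k _; rewrite IHu // all_cat St all_nseq Sv orbT.
have out s : s != [::] -> all (pred1 v) s -> word_act N u (restrict S phi) (t ++ s) = 0.
  case: s => // w s _ /andP[/eqP -> _]; apply: (word_act_supp N u supp).
  by rewrite all_cat /= (negPf Sv) andbF.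
rewrite IHu // /letter_act; case: b => /=.
  by rewrite -cats1 out ?addr0 //= eqxx.
case: N N0 {tp IHu} out => // N _ out.
rewrite big_ord_recl /= cats0 expr0 mul1r big1 ?addr0 // => k _.
by rewrite (out (v :: nseq k v)) ?mulr0 //= all_nseq /= eqxx orbT.
Qed.

Section Centralizer.
Variable v : Gamma.

(** With [rest]: a word t equals v^(lead t) (rest t) in the partially commutative
monoid, with as many letters v as possible moved to the front. These are the
letters v that precede the first letter outside the star of v. *)
Fixpoint lead t : nat := if t is x :: t' then
  if x == v then (lead t').+1 else if edge v x then lead t' else 0%N else 0%N.
Fixpoint rest t := if t is x :: t' then
  if x == v then rest t' else if edge v x then x :: rest t' else t else [::].

Lemma size_rest t : (size (rest t) + lead t)%N = size t.
Proof.
elim: t => //= x t IHt; case: (x == v); first by rewrite addnS IHt.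
by case: (edge v x); rewrite /= ?addn0 // addSn IHt.
Qed.

Lemma lead_front phi s t : trace_inv phi ->
  phi (s ++ nseq (lead t) v ++ rest t) = phi (s ++ t).
Proof.
move=> inv; elim: t s => //= x t IHt s; case: eqP => [->|_] /=.
  by rewrite -!cat_rcons IHt.
case: ifP => // vx; rewrite -[in RHS]cat_rcons -IHt cat_rcons.
elim: (lead t) s => //= k IHk s.
by rewrite -cat_rcons IHk cat_rcons inv // edge_sym.
Qed.

Lemma all_star_rest t : all (star v) t -> all (star v) (rest t).
Proof.
elim: t => //= x t IHt /andP[vx /IHt at']; case: eqP => [//|/eqP/negPf xv].
by move: vx; rewrite /star xv /= => vx; rewrite vx /= /star vx orbT.
Qed.

Lemma lead_rcons t : ~~ all (star v) t -> lead (rcons t v) = lead t.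
Proof.
elim: t => //= x t IHt; rewrite /star; case: (x == v) => /=;
  first by move/IHt->.
by case: (edge v x).
Qed.

Lemma rest_rcons t : ~~ all (star v) t -> rest (rcons t v) = rcons (rest t) v.
Proof.
elim: t => //= x t IHt; rewrite /star; case: (x == v) => /=;
  first by move/IHt->.
by case: (edge v x) => //= /IHt->.
Qed.

Lemma lead_swap s t (x y : Gamma) : edge x y ->
  lead (s ++ x :: y :: t) = lead (s ++ y :: x :: t).
Proof.
move=> xy; elim: s => [|z s IHs] /=; last by rewrite IHs.
have [xv|xv] := eqVneq x v; have [yv|yv] := eqVneq y v => //=.
- by move: xy; rewrite xv => ->.
- by move: xy; rewrite yv edge_sym => ->.
- by case: (edge v x); case: (edge v y).
Qed.

Lemma rest_swap phi s t (x y : Gamma) p q : trace_inv phi -> edge x y ->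
  phi (p ++ rest (s ++ x :: y :: t) ++ q) = phi (p ++ rest (s ++ y :: x :: t) ++ q).
Proof.
move=> inv xy; elim: s p => [|z s IHs] p /=; last first.
  case: (z == v) => //; case: (edge v z);
    first by rewrite /= -!(cat_rcons z p); exact: IHs.
  by have := inv (p ++ z :: s) (t ++ q) _ _ xy; rewrite -!catA /= -!catA.
have [xv|xv] := eqVneq x v; have [yv|yv] := eqVneq y v => //=.
- by move: xy; rewrite xv => ->.
- by move: xy; rewrite yv edge_sym => ->.
- by case: (edge v x); case: (edge v y); rewrite /= (inv _ _ _ _ xy).
Qed.

(** A solution of psi(t v) - psi(v t) = phi(t) for forms phi supported on the
words with a letter outside the star of v ([potential_boundary]). Moving the
leading letters v of t = v^k r to the end, one at a time, leads to r v^k, where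
psi vanishes; psi(t) collects the values of phi met on the way. *)
Definition potential phi t : K :=
  - \sum_(i < lead t) phi (nseq ((lead t).-1 - i) v ++ rest t ++ nseq i v).

Lemma trace_form_potential N phi : trace_form N phi ->
  trace_form N.+1 (potential phi).
Proof.
move=> [inv top]; split=> [s t x y xy|t Nt]; rewrite /potential.
  congr (- _); rewrite (lead_swap s t xy); apply: eq_bigr => i _;
    exact: rest_swap.
rewrite -[RHS]oppr0; congr (- _); rewrite big1 // => i _; apply: top.
rewrite !size_cat !size_nseq; have := size_rest t; have := ltn_ord i; lia.
Qed.

Lemma potential_boundary phi t : trace_inv phi ->
    (forall t, all (star v) t -> phi t = 0) ->
  potential phi (rcons t v) = potential phi (v :: t) + phi t.
Proof.
move=> inv supp; have [at'|nat'] := boolP (all (star v) t).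
  have pot0 s : all (star v) s -> potential phi s = 0.
    move=> sP; rewrite /potential big1 ?oppr0 // => i _; apply: supp.
    by rewrite !all_cat !all_nseq /star eqxx !orbT all_star_rest.
  have sv : star v v by rewrite /star eqxx.
  by rewrite !pot0 ?supp ?addr0 //= ?all_rcons ?sv.
rewrite /potential /= eqxx lead_rcons // rest_rcons // big_ord_recl subn0 cats0.
rewrite (lead_front [::]) // opprD addrAC addNr add0r; congr (- _).
apply: eq_bigr => i _; rewrite /= cat_rcons; congr (phi (nseq _ v ++ _)).
by rewrite /bump; have := ltn_ord i; lia.
Qed.

(** If a commutes with v, then psi(. v) and psi(v .) take the same value at a for
every form psi. By [potential_boundary] this means that every form supported on
the words with a letter outside the star of v vanishes at a. *)
Lemma magnus_centralizer N a : (0 < N)%N ->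
    magnus_eq K N.+1 (gen v * a)%g (a * gen v)%g ->
  magnus_eq K N a (retract (star v) a).
Proof.
move=> N0 comm phi tp; rewrite coef_retract //.
have [phi' [phiE tp' supp]] : exists phi', [/\ restrict (star v) phi \+ phi' = phi,
    trace_form N phi' & forall t, all (star v) t -> phi' t = 0].
  exists (phi \+ (fun t => -1 * restrict (star v) phi t)); split.
  - by apply/funext => t /=; ring.
  - by apply: trace_formD => //; apply: trace_formZ; exact: trace_form_restrict.
  - by move=> t ta; rewrite /= /restrict ta mulN1r subrr.
have tpot := trace_form_potential tp'; have [inv' _] := tp'.
have := comm _ tpot; rewrite !coefM //.
have -> : magnus N.+1 (gen v) (potential phi') =
    potential phi' \+ (shiftl [:: v] (potential phi') \+ phi').
  apply/funext => t; rewrite magnus_gen //=; congr (_ + _).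
  exact: potential_boundary.
rewrite {1}/coef magnus_gen; last exact: trace_form_magnus.
rewrite /coef !magnusD /= magnus_shiftl => /addrI.
rewrite -[LHS]addr0 => /addrI; rewrite (magnus_index _ (leqnSn N)) // => E.
by rewrite /coef -{1}phiE magnusD /= -E addr0.
Qed.

End Centralizer.
End Restriction.

(** * Automorphisms whose square is inner *)

Section Inner.
Local Open Scope group_scope.
Variable Gamma : sgraph.
Local Notation A := (raag Gamma).
Implicit Types (v w : Gamma) (x y g : A) (c : group_aut A).

Lemma magnus_eq_eq x y : (forall m N, magnus_eq (Z3 m) N.+1 x y) -> x = y.
Proof.
move=> xy; apply: (mulIg y^-1); rewrite mulgV; apply: magnus_faithful => m N.
by rewrite -(mulgV y); apply: magnus_eqM.
Qed.

Lemma Z3_char m : ((3 ^ m.+1)%:R = 0 :> Z3 m)%R.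
Proof. by rewrite pchar_Zp // -(expn0 3) ltn_exp2l. Qed.

Lemma magnus_eq_retract (K : comNzRingType) N S x y : (0 < N)%N ->
  magnus_eq K N x y -> magnus_eq K N (retract S x) (retract S y).
Proof.
move=> N0 xy phi tp; rewrite !coef_retract // xy //; exact: trace_form_restrict.
Qed.

(** Substituting the relation for one vertex into the relation for another
composes the retractions, and only multiplies B by an element that does not
depend on K, N or x. *)
Lemma retract_descent (b : Gamma -> A) (s : seq Gamma) : exists B,
  forall (K : comNzRingType) N x, (0 < N)%N ->
    (forall v, magnus_eq K N x (b v * retract (star v) x)) ->
  magnus_eq K N x (B * retract (fun u => all (fun v => star v u) s) x).
Proof.
elim: s => [|v s [B IH]].
  by exists 1 => K N x _ _; rewrite mul1g retract_T.
set S := (fun u => all _ s) in IH *.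
exists (B * retract S (b v)) => K N x N0 bx.
apply: (magnus_eq_trans (IH K N x N0 bx)); rewrite -mulgA.
apply: magnus_eqM; first exact: magnus_eq_refl.
have := magnus_eq_retract S N0 (bx v).
by rewrite retractM retract_comp.
Qed.

(** If z is the power of g approximating c by conjugation and c v = v^(a v), then
a v * z commutes with v up to degree N, and [magnus_centralizer] relates z to its
retraction onto the star of v by a factor that does not depend on the precision.
By [retract_descent], z is then a fixed element B of the group times a central
one. *)
Lemma unipotent_square_inner c g : (forall w x, expo w (c x) = expo w x) ->
    (forall x, c (c x) = x ^ g) ->
  inner c.
Proof.
move=> cE cc; have approx m N := involution_approx (Z3_char m) N (@group_autM _ c) cE cc.
have conj v : exists h, c (gen v) = gen v ^ h.
  by apply: magnus_conj_gen => m N; have [j jP] := approx m N; exists (g ^+ j).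
have [a aP] := choice conj.
have [B BP] := retract_descent (fun v => (a v)^-1 * retract (star v) (a v)) (enum Gamma).
exists B^-1 => x; apply: magnus_eq_eq => m N.
(* one degree is lost in [magnus_centralizer] *)
have [j jP] := approx m N.+2; set z := g ^+ j in jP.
have bz v : magnus_eq (Z3 m) N.+1 z ((a v)^-1 * retract (star v) (a v) * retract (star v) z).
  rewrite -{1}[z](mulKg (a v)) -mulgA -retractM.
  apply: magnus_eqM; first exact: magnus_eq_refl.
  apply: magnus_centralizer => //; have := jP (gen v).
  rewrite aP -conjgM; set y := a v * z => yv.
  by rewrite conjgC; apply: magnus_eqM; first exact: magnus_eq_refl.
have {bz} := BP _ _ _ (ltn0Sn N) bz; set zc := retract _ z => zB.
have zcC y : commute zc y.
  rewrite /zc (_ : retract _ z = retract (fun u => [forall v, star v u]) z).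
    exact: retract_central.
  apply: eq_retract => u; apply/allP/forallP => uP v.
    by apply: uP; rewrite mem_enum.
  by move=> _; exact: uP.
rewrite -[c x](conjgK z); apply: (@magnus_eq_trans _ _ _ (x ^ z^-1)).
  apply: magnus_eqJ; last exact: magnus_eq_refl.
  exact: magnus_eq_leq (leqnSn _) (jP x).
have -> : x ^ B^-1 = x ^ (B * zc)^-1.
  rewrite invgM conjgM; congr (_ ^ _); apply/esym/conjg_fixP.
  by apply/commgP/commuteV/commute_sym.
by apply: magnus_eqJ; [exact: magnus_eq_refl | exact: magnus_eqV].
Qed.

(** The approximating conjugations are by powers of 1. *)
Lemma unipotent_involution_trivial c : (forall w x, expo w (c x) = expo w x) ->
  (forall x, c (c x) = x) -> c = 1.
Proof.
move=> cE cc; apply: group_autP => x; apply: magnus_eq_eq => m N.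
have c1 y : c (c y) = y ^ 1 by rewrite conjg1.
have [j /(_ x)] := involution_approx (Z3_char m) N.+1 (@group_autM _ c) cE c1.
by rewrite expg1n conjg1.
Qed.

Hypothesis asym : asymmetric Gamma.
Implicit Types (f h : group_aut A).

Lemma commutator_unipotent f h : inner ([~ f, h] * [~ f, h]) ->
  forall w x, expo w ([~ f, h] x) = expo w x.
Proof.
move=> [g cc]; apply: (unipotent_involution asym) => [v|w x].
  exact: aut_diagR.
by rewrite -group_aut_mulE cc expo_conj.
Qed.

Lemma commutator_inner f h : inner ([~ f, h] * [~ f, h]) -> inner [~ f, h].
Proof.
move=> cc; have [g gP] := cc.
by apply: (unipotent_square_inner (commutator_unipotent cc)) => x; exact: gP.
Qed.

Lemma commutator_trivial f h : [~ f, h] * [~ f, h] = 1 -> [~ f, h] = 1.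
Proof.
move=> cc; apply: unipotent_involution_trivial.
  by apply: commutator_unipotent; rewrite cc; exact: inner1.
by move=> x; rewrite -group_aut_mulE cc.
Qed.

End Inner.

(** * Non-commuting symmetries of a graph *)

Section Symmetries.
Local Open Scope group_scope.
Variable Lambda : sgraph.
Local Notation A := (raag Lambda).
Implicit Types (v w : Lambda) (f h : group_aut A).

Lemma group_aut_eq f h : (forall v, f (gen v) = h (gen v)) -> f = h.
Proof.
by move=> fh; apply/group_autP/(raag_morph_eq (@group_autM _ f) (@group_autM _ h)).
Qed.

Lemma raag_aut_exists (F F' : Lambda -> A) :
    (forall v w, edge v w -> commute (F v) (F w)) ->
    (forall v w, edge v w -> commute (F' v) (F' w)) ->
    (forall v, raag_lift F' (F v) = gen v) ->
    (forall v, raag_lift F (F' v) = gen v) ->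
  exists f, forall v, f (gen v) = F v.
Proof.
move=> FC FC' F'F FF'; have FM := raag_liftM FC; have FM' := raag_liftM FC'.
have fP : is_group_aut (raag_lift F).
  apply/asboolP; split=> //; exists (raag_lift F').
    apply: (@raag_morph_eq _ _ (raag_lift F' \o raag_lift F) idfun)
      => // [x y|v] /=; first by rewrite FM FM'.
    by rewrite raag_lift_gen.
  apply: (@raag_morph_eq _ _ (raag_lift F \o raag_lift F') idfun)
    => // [x y|v] /=; first by rewrite FM' FM.
  by rewrite raag_lift_gen.
by exists (GroupAut fP) => v; exact: raag_lift_gen.
Qed.

Lemma graph_aut_raag (s : {perm Lambda}) : s \in graph_aut Lambda ->
  exists f, forall v, f (gen v) = gen (s v).
Proof.
have lifts (t : {perm Lambda}) : t \in graph_aut Lambda ->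
    forall v w, edge v w -> commute (gen (t v)) (gen (t w)).
  by rewrite inE => /'forall_'forall_eqP tP v w vw; apply: gen_commute;
    rewrite tP.
move=> sP; have sVP : s^-1 \in graph_aut Lambda by rewrite groupV.
apply: (raag_aut_exists (lifts _ sP) (lifts _ sVP)).
- by move=> v; rewrite raag_lift_gen ?permK //; exact: lifts.
- by move=> v; rewrite raag_lift_gen ?permKV //; exact: lifts.
Qed.

Definition flip_gen v u : A := if u == v then (gen u)^-1 else gen u.

Lemma flip_raag v : exists f, forall u, f (gen u) = flip_gen v u.
Proof.
have comm u w : edge u w -> commute (flip_gen v u) (flip_gen v w).
  move/gen_commute => uw; rewrite /flip_gen.
  have uwV : commute (gen u) (if w == v then (gen w)^-1 else gen w).
    by case: ifP => // _; exact: commuteV.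
  by case: ifP => // _; apply/commute_sym/commuteV/commute_sym.
have gE u : raag_lift (flip_gen v) (gen u) = flip_gen v u by exact: raag_lift_gen.
have lM := raag_liftM comm.
have inv u : raag_lift (flip_gen v) (flip_gen v u) = gen u.
  rewrite {2}/flip_gen; case: ifP => uv; last by rewrite gE /flip_gen uv.
  by rewrite (morph_inv lM) gE /flip_gen uv invgK.
exact: (raag_aut_exists comm comm inv inv).
Qed.

Lemma asymmetricPn : ~ asymmetric Lambda ->
  exists s v, s \in graph_aut Lambda /\ s v != v.
Proof.
move=> nasym; case: (pselect (exists s v, s \in graph_aut Lambda /\ s v != v)) => // no_s.
case: nasym; apply/eqP; rewrite eqEsubset sub1G andbT; apply/subsetP => s sP.
rewrite inE; apply/eqP/permP => v; rewrite perm1; apply/eqP/negPn/negP => sv.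
by apply: no_s; exists s, v.
Qed.

(** The commutator of the inversion of v = s w with s is the product of the
inversions of v and w, which sends w to its inverse and so has exponent sum -1
where an inner automorphism has 1. *)
Lemma symmetric_commutator : ~ asymmetric Lambda ->
  exists f h, [~ f, h] * [~ f, h] = 1 /\ ~ inner [~ f, h].
Proof.
move=> /asymmetricPn[s [w [sP sw]]]; set v := s w in sw.
have [iv ivE] := flip_raag v; have [iw iwE] := flip_raag w.
have [h hE] := graph_aut_raag sP.
have sq u (i : group_aut A) : (forall t, i (gen t) = flip_gen u t) -> i * i = 1.
  move=> iE; apply: group_aut_eq => t; rewrite group_aut_mulE iE /flip_gen.
  by case: ifP => tu; rewrite ?group_autV iE /flip_gen tu ?invgK.
have sqv := sq v iv ivE; have sqw := sq w iw iwE.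
have conj : iv * h = h * iw.
  apply: group_aut_eq => t; rewrite !group_aut_mulE hE ivE iwE /flip_gen.
  rewrite /v (inj_eq perm_inj); case: ifP => _; by rewrite ?group_autV hE.
have comm : iv * iw = iw * iv.
  apply: group_aut_eq => t; rewrite !group_aut_mulE iwE ivE /flip_gen.
  case: ifP => tw; case: ifP => tv;
    rewrite ?group_autV ivE iwE /flip_gen tw tv //.
exists iv, h; have cE : [~ iv, h] = iv * iw.
  rewrite commgEl conjgE conj mulKg; congr (_ * _).
  by apply: (mulgI iv); rewrite mulgV sqv.
rewrite cE; split; first by rewrite {2}comm mulgA -(mulgA iv) sqw mulg1 sqv.
case=> a /(_ (gen w)) /(congr1 (expo w));
  rewrite expo_conj group_aut_mulE iwE /flip_gen eqxx.
rewrite group_autV ivE /flip_gen eq_sym (negPf sw) expo_gen eqxx.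
have := expoM w (gen w)^-1 (gen w); rewrite mulVg expo1 expo_gen eqxx => E1 E2.
by move: E1; rewrite E2.
Qed.

End Symmetries.

(** * Comparison of automorphism groups *)

Lemma morph_commg (G H : groupType) (f : G -> H) :
  {morph f : x y / (x * y)%g} -> {morph f : x y / [~ x, y]%g}.
Proof.
by move=> fM x y; rewrite !commgEl !conjgE !fM !(morph_inv fM).
Qed.

Theorem corollary5p9 (Gamma Lambda : sgraph) (Gamma_asym : asymmetric Gamma) :
  (embeds (group_aut (raag Lambda)) (group_aut (raag Gamma)) ->
     asymmetric Lambda) /\
  (embeds (group_out (raag Lambda)) (group_out (raag Gamma)) ->
     asymmetric Lambda).
Proof.
split=> -[F F_inj]; apply: contrapT => /symmetric_commutator[f [h [sq not_inner]]].
  have FM : {morph F : x y / (x * y)%g} by exact: gmulfM.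
  apply: not_inner; suff -> : [~ f, h]%g = 1%g by exact: inner1.
  apply: F_inj; rewrite (morph_one FM) (morph_commg FM).
  by apply: commutator_trivial => //;
    rewrite -(morph_commg FM) -FM sq morph_one.
have FM : {morph F : x y / (x * y)%g} by exact: gmulfM.
pose piL : group_aut (raag Lambda) -> group_out (raag Lambda) := \pi_(group_out _)%qT.
pose piG : group_aut (raag Gamma) -> group_out (raag Gamma) := \pi_(group_out _)%qT.
have piLM : {morph piL : x y / (x * y)%g} by move=> x y;
  exact/esym/group_out_mulE.
have piGM : {morph piG : x y / (x * y)%g} by move=> x y;
  exact/esym/group_out_mulE.
pose c := [~ repr (F (piL f)), repr (F (piL h))]%g.
have cE : piG c = F (piL [~ f, h]%g).
  rewrite (morph_commg piGM) (morph_commg piLM) (morph_commg FM).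
  by congr [~ _, _]%g; exact: generic_quotient.reprK.
have pi1 x : piG x = 1%g -> inner x.
  rewrite -(morph_one piGM) => /esym/eqP/group_out_eqP.
  by rewrite invg1 mul1g.
have : inner c.
  apply: commutator_inner => //; apply: pi1.
  by rewrite piGM cE -FM -piLM sq !morph_one.
move=> c_inner; apply: not_inner.
suff : piL [~ f, h]%g = 1%g.
  rewrite -(morph_one piLM) => /esym/eqP/group_out_eqP.
  by rewrite invg1 mul1g.
apply: F_inj; rewrite -cE (morph_one FM) -(morph_one piGM).
by apply/esym/eqP/group_out_eqP; rewrite invg1 mul1g.
Qed.
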